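(* Let $n\ge 3$ and let $\mathcal{D}$ be a holomorphic distribution of codimension one and degree $m$ on $\mathbb{P}^{n}$, induced by $\omega\in H^{0}(\mathbb{P}^{n},\Omega^{1}_{\mathbb{P}^{n}}(m+2))$, whose singular set has only isolated singularities. For an integer $d$, let $V_d=\{X\in H^{0}(\mathbb{P}^{n},T_{\mathbb{P}^{n}}(d-1)) : i_X\omega=0\}$ be the space of vector fields of degree $d$ invariant by $\mathcal{D}$. Suppose that the integer $d$ satisfies (1) $m+1\le d<2(m+1)$; (2) $d\ne\left(\frac{n}{2}\right)m$ if $n$ is even; (3) $d\ne\left(\frac{n-1}{2}\right)m-1$ and $d\ne\left(\frac{n+1}{2}\right)m+1$ if $n$ is odd. Then there are $$\binom{d-m+n}{d-m+n-2}\binom{d-m+n-3}{n-2}$$ linearly independent vector fields of degree $d$ on $\mathbb{P}^{n}$ invariant by $\mathcal{D}$, i.e. $\dim_{\mathbb{C}} V_d$ equals this number. Moreover, if $d<m+1$, then there is no nontrivial vector field of degree $d$ invariant by $\mathcal{D}$ (i.e. $V_d=0$) in the case $n$ even, and also in the case $n$ odd provided $d\ne\left(\frac{n-1}{2}\right)m-1$.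
   Context: $\mathbb{P}^n$ is complex projective space. A codimension one holomorphic distribution of degree $m$ on $\mathbb{P}^{n}$ is induced by a nonzero section $\omega\in H^{0}(\mathbb{P}^{n},\Omega^{1}_{\mathbb{P}^{n}}(m+2))$; its singular set is the zero set of $\omega$, and is assumed to be nonempty. A vector field of degree $d$ on $\mathbb{P}^{n}$ is a section of $T_{\mathbb{P}^{n}}(d-1)$; it is invariant by $\mathcal{D}$ (tangent to $\mathcal{D}$) if $i_X\omega=\omega(X)=0$.
   Formalization: In the ''Moreover'' part for n even, the condition d ≠ (n/2)m is kept; it only excludes m = d = 0, where the claim fails (n = 4, ω = z0dz1−z1dz0+z2dz3−z3dz2, X = ∂/∂z4). *)

(* Defs.v *)
From HB Require Import structures.
From mathcomp Require Import all_boot all_order all_algebra.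
From mathcomp Require Import mpoly.
From mathcomp.real_closed Require Import complex.
From mathcomp Require Import reals.

Set Implicit Arguments.
Unset Strict Implicit.
Unset Printing Implicit Defensive.

Import Order.TTheory GRing.Theory Num.Theory.
Local Open Scope ring_scope.

(* P^n over C = R[i] is given by its n+1 standard affine charts.  The i-th    *)
(* chart U_i = {z_i != 0} is identified with C^n by the affine coordinates    *)
(* z_(lift i l) / z_i, for l : 'I_n; its regular functions are the            *)
(* polynomials {mpoly C[n]}.                                                  *)

Section Charts.
Variables (C : fieldType) (n : nat).

(* Homogeneous coordinates of a point of U_i, normalised by z_i = 1.          *)
Definition hcoord (i : 'I_n.+1) (x : 'I_n -> C) (k : 'I_n.+1) : C :=
  if unlift i k is Some l then x l else 1.

(* A tangent vector of U_i, seen in the hyperplane dz_i = 0 tangent to        *)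
(* {z_i = 1}.                                                                 *)
Definition hvec (i : 'I_n.+1) (v : 'I_n -> C) (k : 'I_n.+1) : C :=
  if unlift i k is Some l then v l else 0.

(* The change of charts U_i -> U_j, z |-> z / z_j; it is meaningful where     *)
(* hcoord i x j != 0, i.e. on the overlap of U_i and U_j.                     *)
Definition trans (i j : 'I_n.+1) (x : 'I_n -> C) (l : 'I_n) : C :=
  hcoord i x (lift j l) / hcoord i x j.

(* Its differential at x, applied to v (quotient rule).                       *)
Definition dtrans (i j : 'I_n.+1) (x v : 'I_n -> C) (l : 'I_n) : C :=
  (hvec i v (lift j l) * hcoord i x j - hcoord i x (lift j l) * hvec i v j)
    / hcoord i x j ^+ 2.

(* The components, in each chart, of a vector field (along d/dx_l) or of a    *)
(* 1-form (along dx_l) with values in a line bundle trivialised over the      *)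
(* charts.                                                                    *)
Definition chart_family := {ffun 'I_n.+1 -> {ffun 'I_n -> {mpoly C[n]}}}.

Definition fvec (X : chart_family) (i : 'I_n.+1) (x : 'I_n -> C) (l : 'I_n) : C :=
  (X i l).@[x].

Definition fform (w : chart_family) (i : 'I_n.+1) (x v : 'I_n -> C) : C :=
  \sum_l (w i l).@[x] * v l.

(* O(k) is trivialised over U_i by z_i^k.  A section of O(k), seen as a       *)
(* function on the cone homogeneous of degree k, is then represented in U_i   *)
(* by its restriction to {z_i = 1}, so that passing from U_i to U_j           *)
(* multiplies representatives by (z_j / z_i)^(- k).                           *)

(* X is a global section of T_{P^n}(k). *)
Definition twisted_vfield (k : int) (X : chart_family) : Prop :=
  forall (i j : 'I_n.+1) (x : 'I_n -> C), hcoord i x j != 0 ->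
  forall l, fvec X j (trans i j x) l
            = hcoord i x j ^ (- k) * dtrans i j x (fvec X i x) l.

(* w is a global section of Omega^1_{P^n}(k). *)
Definition twisted_form (k : int) (w : chart_family) : Prop :=
  forall (i j : 'I_n.+1) (x : 'I_n -> C), hcoord i x j != 0 ->
  forall v, fform w j (trans i j x) (dtrans i j x v)
            = hcoord i x j ^ (- k) * fform w i x v.

(* i_X w, in the chart U_i. *)
Definition contraction (X w : chart_family) (i : 'I_n.+1) : {mpoly C[n]} :=
  \sum_l w i l * X i l.

Definition vfield_of_degree (d : int) (X : chart_family) : Prop :=
  twisted_vfield (d - 1) X.

(* X belongs to the space V_d attached to w. *)
Definition invariant_vfield (w : chart_family) (d : int) (X : chart_family)
  : Prop :=
  vfield_of_degree d X /\ forall i, contraction X w i = 0.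

(* w induces a codimension one distribution of degree m; the singular set is  *)
(* dealt with separately.                                                     *)
Definition induces_distribution (m : int) (w : chart_family) : Prop :=
  w != 0 /\ twisted_form (m + 2) w.

(* The point x of U_i is a zero of w. *)
Definition singular_at (w : chart_family) (i : 'I_n.+1) (x : 'I_n -> C) : Prop :=
  forall l, (w i l).@[x] = 0.

Definition has_singularity (w : chart_family) : Prop :=
  exists i x, singular_at w i x.

End Charts.

(* Isolated for the classical topology of P^n, in which U_i is open.  The     *)
(* order and norm are those of R[i], so that 0 < e means that e is a positive *)
(* real number.                                                               *)
Definition isolated_singularities (R : realType) (n : nat)
    (w : chart_family R[i] n) : Prop :=
  forall i x, singular_at w i x ->
  exists2 e : R[i], 0 < e &
    forall y, singular_at w i y -> (forall l, `|y l - x l| < e) -> y =1 x.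

(* V has a basis with N elements; for a linear subspace V of a possibly       *)
(* infinite-dimensional L this says that dim V = N.                           *)
Definition has_dim (F : fieldType) (L : lmodType F) (V : L -> Prop) (N : nat)
  : Prop :=
  exists b : 'I_N -> L,
    [/\ forall i, V (b i),
        forall c : 'I_N -> F, \sum_i c i *: b i = 0 -> forall i, c i = 0
      & forall X, V X -> exists c : 'I_N -> F, X = \sum_i c i *: b i].

(* Main.v *)
Require Import Defs.
From HB Require Import structures.
From mathcomp Require Import all_boot all_order all_algebra.
From mathcomp Require Import mpoly.
From mathcomp.real_closed Require Import complex.
From mathcomp Require Import reals.
From mathcomp Require boolp.
From mathcomp Require Import ring lra zify.
Import Order.TTheory GRing.Theory Num.Theory.
Local Open Scope ring_scope.

Set Implicit Arguments.
Unset Strict Implicit.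
Unset Printing Implicit Defensive.

(** Let S = C[z_0, ..., z_n] and N = n + 1.  On the cone over P^n the form w
    becomes the sum of the a_k dz_k, where the a_k in S are homogeneous of
    degree m + 1 and the sum of the z_k a_k vanishes; a vector field of degree d
    becomes the sum of the Y_k d/dz_k, where the Y_k are homogeneous of degree
    d, modulo the multiples of the Euler field z = (z_0, ..., z_n); tangency to
    the distribution says that the sum of the a_k Y_k vanishes
    ([form_of_family], [family_of_vfield], [invariant_lift]).

    The exterior algebra of S^N carries two anticommuting differentials: the
    contraction d with (a_0, ..., a_n), and the wedge product e with z.  Thus V_d
    is the kernel of d on vectors of polynomial degree d, modulo the image of e.

    The differential e is exact, except on the constants in top exterior degree
    N, because of Euler's identity ([ekz_exact]).  The differential d is exact in
    exterior degrees at least 2 ([koszul_exact]).  From these two facts alone the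
    theorem follows by a zigzag ([double_chase]): if d y = 0 then
    e y = d y', e y' = d y'', and so on with y', y'', ... of exterior degree
    3, 5, ...; at the top of the exterior algebra the zigzag stops, the last term
    is in the image of e unless it is a nonzero constant of exterior degree N,
    and going back one gets y = d u + e v.  The last term has polynomial degree
    d - s m with 1 + 2 s = N, which is 0 exactly when n is even and d = (n/2) m.
    Hence contraction maps the bivectors of polynomial degree d - m - 1 onto V_d.
    The same zigzag, started at a bivector, shows that the kernel of this map
    consists of the multiples of z, as long as d < 2 (m + 1) and, for n odd,
    d <> ((n + 1)/2) m + 1.  If d < m + 1 there are no bivectors of degree
    d - m - 1, so V_d = 0; otherwise the dimension of V_d is the alternating sum
    of the dimensions of the spaces of bivectors, vectors and functions of
    polynomial degrees d - m - 1, d - m - 2 and d - m - 3, because the complex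
    defined by e is exact there ([bin_count]).

    The exactness of d is where the singularities enter.  Isolated points form a
    countable set, while C is uncountable, so that some linear form l vanishes at
    no singular point ([avoiding_hyperplane]).  Then a_0, ..., a_n and l^(m+1)
    have no common zero but the origin, and the Nullstellensatz puts a power of
    each z_i into the ideal that they generate.  The Koszul homology of n + 2
    elements generating such an ideal vanishes in degrees greater than
    (n + 2) - (n + 1) = 1 ([exact_of_powers]), and a graded form of Nakayama's
    lemma removes l^(m+1) ([exact_of_cone]).  The Nullstellensatz has a short
    proof that uses the uncountability of C once more ([ideal_extend]). *)

(** * The exterior algebra, its contractions and its wedge products *)

(** The exterior algebra on generators e_0, ..., e_(N-1), with coefficients in M:
    the pair (x1, x2) stands for x1 + e_(N-1) /\ x2.  This encoding needs no
    signs indexed by subsets, and all identities become inductions on N. *)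
Fixpoint kos (C : fieldType) (M : lmodType C) (N : nat) : lmodType C :=
  if N is N'.+1 then (kos M N' * kos M N')%type : lmodType C else M.

Section Maps.
Variable C : fieldType.
Implicit Types M : lmodType C.

Fixpoint kmap M M' (f : M -> M') N : kos M N -> kos M' N :=
  if N is N'.+1 then fun x => (kmap f x.1, kmap f x.2) else f.

Fact kmap_is_linear M M' (f : {linear M -> M'}) N : linear (@kmap M M' f N).
Proof.
elim: N => [|N IHN] a x y /=; first exact: linearP.
by rewrite !IHN.
Qed.
HB.instance Definition _ M M' (f : {linear M -> M'}) N :=
  GRing.isLinear.Build C (kos M N) (kos M' N) *:%R (@kmap M M' f N)
    (kmap_is_linear f (N := N)).

Lemma kmap_comp M M' M'' (f : M' -> M'') (g : M -> M') N (x : kos M N) :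
  kmap f (kmap g x) = kmap (f \o g) x.
Proof. by elim: N x => [|N IHN] x //=; rewrite !IHN. Qed.

Lemma eq_kmap M M' (f g : M -> M') N (x : kos M N) :
  f =1 g -> kmap f x = kmap g x.
Proof. by move=> fg; elim: N x => [|N IHN] x //=; rewrite !IHN. Qed.

Lemma kmap_id M N (x : kos M N) : kmap id x = x.
Proof. by elim: N x => [|N IHN] //= -[x1 x2] /=; rewrite !IHN. Qed.

Lemma kmapD M M' (f g : {linear M -> M'}) N (x : kos M N) :
  kmap (fun c => f c + g c) x = kmap f x + kmap g x.
Proof. by elim: N x => [|N IHN] x //=; rewrite !IHN. Qed.

(** The contraction with (y_0, ..., y_(N-1)).  The coefficients are operators on
    M rather than scalars, so that [dk] is a Koszul differential when they are
    multiplications, and a divergence when they are partial derivatives. *)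
Fixpoint dk M (y : nat -> {linear M -> M}) N : kos M N -> kos M N :=
  if N is N'.+1 then fun x => (dk y x.1 + kmap (y N') x.2, - dk y x.2)
  else fun=> 0.

(** The wedge product with the vector (z_0, ..., z_(N-1)), from the left. *)
Fixpoint ek M (z : nat -> {linear M -> M}) N : kos M N -> kos M N :=
  if N is N'.+1 then fun x => (ek z x.1, kmap (z N') x.1 - ek z x.2)
  else fun=> 0.

Fact dk_is_linear M y N : linear (@dk M y N).
Proof.
elim: N => [|N IHN] a x x' /=; first by rewrite scaler0 addr0.
rewrite !IHN !linearP /=; congr pair.
  by rewrite /= scalerDr addrACA.
Qed.
HB.instance Definition _ M y N :=
  GRing.isLinear.Build C (kos M N) (kos M N) *:%R (@dk M y N)
    (@dk_is_linear M y N).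

Fact ek_is_linear M z N : linear (@ek M z N).
Proof.
elim: N => [|N IHN] a x x' /=; first by rewrite scaler0 addr0.
rewrite !IHN !linearP /=; congr pair.
by rewrite [RHS]/= scalerBr scalerN addrACA.
Qed.
HB.instance Definition _ M z N :=
  GRing.isLinear.Build C (kos M N) (kos M N) *:%R (@ek M z N)
    (@ek_is_linear M z N).

Section Ops.
Variable M : lmodType C.
Implicit Types y z : nat -> {linear M -> M}.

Lemma kmap_dk M' (f : {linear M -> M'}) y (y' : nat -> {linear M' -> M'}) N (x : kos M N) :
  (forall i, (i < N)%N -> forall c, f (y i c) = y' i (f c)) ->
  kmap f (dk y x) = dk y' (kmap f x).
Proof.
elim: N x => [|N IHN] x fy /=; first by rewrite linear0.
rewrite linearD linearN /= !IHN => [|i iN|i iN]; try exact/fy/ltnW.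
by rewrite !kmap_comp (@eq_kmap _ _ (f \o y N) (y' N \o f)) // => c /=; exact: fy.
Qed.

Lemma kmap_ek M' (f : {linear M -> M'}) z (z' : nat -> {linear M' -> M'}) N (x : kos M N) :
  (forall i, (i < N)%N -> forall c, f (z i c) = z' i (f c)) ->
  kmap f (ek z x) = ek z' (kmap f x).
Proof.
elim: N x => [|N IHN] x fz /=; first by rewrite linear0.
rewrite linearB /= !IHN => [|i iN|i iN]; try exact/fz/ltnW.
by rewrite !kmap_comp (@eq_kmap _ _ (f \o z N) (z' N \o f)) // => c /=; exact: fz.
Qed.

Definition commute_below N y z :=
  forall i j, (i < N)%N -> (j < N)%N -> forall c, y i (z j c) = z j (y i c).

Lemma commute_belowS N y z : commute_below N.+1 y z -> commute_below N y z.
Proof. by move=> yz i j iN jN; apply: yz; exact: ltnW. Qed.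

Lemma ekek z N (x : kos M N) : commute_below N z z -> ek z (ek z x) = 0.
Proof.
elim: N x => [|N IHN] //= x zz.
rewrite linearB /= !IHN; try exact: commute_belowS.
rewrite (@kmap_ek _ _ z z) => [|i iN c]; last by apply: zz => //; exact: ltnW.
by rewrite subr0 subrr.
Qed.

Lemma dkdk y N (x : kos M N) : commute_below N y y -> dk y (dk y x) = 0.
Proof.
elim: N x => [|N IHN] //= x yy.
rewrite linearD !linearN /= !IHN; try exact: commute_belowS.
rewrite -(@kmap_dk _ _ y y) => [|i iN c]; last by apply: yy => //; exact: ltnW.
by rewrite add0r subrr !oppr0.
Qed.
End Ops.

Definition subspace M (H : M -> Prop) :=
  H 0 /\ forall a b c, H b -> H c -> H (a *: b + c).

Lemma subspaceZ M (H : M -> Prop) a c : subspace H -> H c -> H (a *: c).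
Proof. by case=> H0 HD Hc; rewrite -[a *: c]addr0; apply: HD. Qed.

Lemma subspaceD M (H : M -> Prop) b c : subspace H -> H b -> H c -> H (b + c).
Proof. by case=> H0 HD Hb Hc; rewrite -[b]scale1r; apply: HD. Qed.

Lemma subspaceN M (H : M -> Prop) c : subspace H -> H c -> H (- c).
Proof. by move=> sH Hc; rewrite -scaleN1r; apply: subspaceZ. Qed.

Lemma subspaceB M (H : M -> Prop) b c : subspace H -> H b -> H c -> H (b - c).
Proof. by move=> sH Hb Hc; apply: subspaceD => //; apply: subspaceN. Qed.

(** The elements of exterior degree p with coefficients in H.  The degree p is
    an integer: negative degrees occur, and contain 0 only. *)
Fixpoint gr M (H : M -> Prop) N (p : int) : kos M N -> Prop :=
  if N is N'.+1 then fun x => gr H p x.1 /\ gr H (p - 1) x.2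
  else fun x => if p == 0 then H x else x = 0.

Section Gr.
Variable M : lmodType C.
Implicit Types (H : M -> Prop) (y z : nat -> {linear M -> M}).

Lemma subspace_gr H N p : subspace H -> subspace (@gr M H N p).
Proof.
case=> H0 HD; elim: N p => [|N IHN] p /=; last first.
  have [[h0 hD] [h0' hD']] := (IHN p, IHN (p - 1)).
  by split=> // a b c [? ?] [? ?]; split; [apply: hD|apply: hD'].
by case: eqP => _; split=> // a _ _ -> ->; rewrite scaler0 addr0.
Qed.

Lemma gr_lt0 H N p (x : kos M N) : p < 0 -> gr H p x -> x = 0.
Proof.
elim: N p x => [|N IHN] p x p_lt0 /=; first by rewrite lt_eqF.
case: x => x1 x2 /= [/IHN-> // /IHN-> //].
by apply: lt_trans p_lt0; rewrite ltrBlDr ltrDl.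
Qed.

Lemma gr_gtN H N p (x : kos M N) : N%:Z < p -> gr H p x -> x = 0.
Proof.
elim: N p x => [|N IHN] p x p_gt /=; first by rewrite gt_eqF.
have p1 : N%:Z < p - 1 by rewrite ltrBrDr addrC -intS.
have p0 : N%:Z < p by apply: lt_trans p_gt; rewrite ltz_nat.
by case: x => x1 x2 /= [/(IHN _ _ p0)-> /(IHN _ _ p1)->].
Qed.

Lemma gr_kmap M' (H' : M' -> Prop) (f : {linear M -> M'}) H N p (x : kos M N) :
  (forall c, H c -> H' (f c)) -> gr H p x -> gr H' p (kmap f x).
Proof.
move=> fH; elim: N p x => [|N IHN] p x /=; last by case=> /IHN ? /IHN ?; split.
by case: eqP => [_ /fH //|_ ->]; rewrite linear0.
Qed.

Lemma gr_dk y H H' N p (x : kos M N) : subspace H' ->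
  (forall i c, (i < N)%N -> H c -> H' (y i c)) ->
  gr H p x -> gr H' (p - 1) (dk y x).
Proof.
move=> sH'; elim: N p x => [|N IHN] p x yH /=.
  by move=> _; case: eqP => _ //; case: sH'.
have yH' i c : (i < N)%N -> H c -> H' (y i c) by move=> iN; apply: yH; apply: ltnW.
move=> [x1 x2]; split; last first.
  by rewrite /=; apply: (subspaceN (subspace_gr _ _ sH')); apply: IHN x2.
rewrite /=; apply: (subspaceD (subspace_gr _ _ sH')); first exact: IHN.
by apply: gr_kmap x2 => c; exact: yH.
Qed.

Lemma gr_ek z H H' N p (x : kos M N) : subspace H' ->
  (forall i c, (i < N)%N -> H c -> H' (z i c)) ->
  gr H p x -> gr H' (p + 1) (ek z x).
Proof.
move=> sH'; elim: N p x => [|N IHN] p x zH /=.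
  by move=> _; case: eqP => _ //; case: sH'.
have zH' i c : (i < N)%N -> H c -> H' (z i c) by move=> iN; apply: zH; apply: ltnW.
move=> [x1 x2]; split; first exact: IHN.
apply: (subspaceB (subspace_gr _ _ sH')).
  by rewrite addrK; apply: gr_kmap x1 => c; exact: zH.
by have:= IHN _ _ zH' x2; rewrite [p - 1 + 1]subrK [p + 1 - 1]addrK.
Qed.

Lemma kmap_lift M' (H' : M' -> Prop) (f : {linear M' -> M}) H N p (x : kos M N) :
  (forall c, H c -> exists2 b, H' b & c = f b) ->
  gr H p x -> exists2 w : kos M' N, gr H' p w & x = kmap f w.
Proof.
move=> fH; elim: N p x => [|N IHN] p x /=; last first.
  case: x => x1 x2 /= [/IHN[w1 h1 ->] /IHN[w2 h2 ->]].
  by exists (w1, w2).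
case: eqP => [_ /fH[b Hb ->]|_ ->]; first by exists b.
by exists 0; rewrite ?linear0.
Qed.

Lemma kmap_eq0 M' (f : M -> M') H N p (x : kos M N) :
  (forall c, H c -> f c = 0 -> c = 0) -> gr H p x -> kmap f x = 0 -> x = 0.
Proof.
move=> fH; elim: N p x => [|N IHN] p x /=; last first.
  by case: x => x1 x2 /= [/IHN h1 /IHN h2] [/h1-> /h2->].
by case: eqP => // _; exact: fH.
Qed.

(** The interaction of contraction and wedge product reduces, by the Clifford
    relations, to the products of the operators with equal indices; the two
    components see them in the two possible orders. *)
Definition anticomm y z N (x : kos M N) := dk y (ek z x) + ek z (dk y x).

Lemma anticommS y z N (x : kos M N.+1) :
  (forall i j, (i < N.+1)%N -> (j < N.+1)%N -> i != j ->
     forall c, y i (z j c) = z j (y i c)) ->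
  anticomm y z x = (anticomm y z x.1 + kmap (y N \o z N) x.1,
                    anticomm y z x.2 + kmap (z N \o y N) x.2).
Proof.
move=> yz; rewrite /anticomm /= !(linearB, linearD, linearN) /=.
rewrite -(@kmap_ek _ _ (y N) z z _ x.2) => [|i iN c]; last first.
  by rewrite yz ?ltnS ?leqnn // 1?ltnW // gtn_eqF.
rewrite -(@kmap_dk _ _ (z N) y y _ x.1) => [|i iN c]; last first.
  by rewrite yz ?ltnS ?leqnn // 1?ltnW // ltn_eqF.
rewrite !kmap_comp; congr pair; rewrite /= ?opprK.
  by rewrite addrACA subrK addrAC.
by rewrite addrACA addKr addrC.
Qed.

Lemma anticomm_mul y z N (x : kos M N) :
  (forall i j, (i < N)%N -> (j < N)%N -> forall c, y i (z j c) = z j (y i c)) ->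
  anticomm y z x = \sum_(i < N) kmap (y i \o z i) x.
Proof.
elim: N x => [|N IHN] x yz; first by rewrite big_ord0 /anticomm /= addr0.
rewrite anticommS => [|i j iN jN _]; last exact: yz.
have yz' i j : (i < N)%N -> (j < N)%N -> forall c, y i (z j c) = z j (y i c).
  by move=> iN jN; apply: yz; apply: ltnW.
rewrite !IHN // big_ord_recr /= [in RHS](surjective_pairing (\sum_(i < N) _)).
rewrite !(big_morph fst (id1 := 0) (op1 := +%R)) //.
rewrite !(big_morph snd (id1 := 0) (op1 := +%R)) //.
congr pair; rewrite /=; congr (_ + _).
by apply: eq_kmap => c /=; rewrite yz.
Qed.

(** When y_i is a derivation dual to z_i, the commutators [y_i, z_i] = 1 count
    the N - p generators that are absent from a monomial of exterior degree p. *)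
Lemma anticomm_div y z N (H : M -> Prop) (p : int) (x : kos M N) : subspace H ->
  (forall i j, (i < N)%N -> (j < N)%N -> i != j ->
     forall c, y i (z j c) = z j (y i c)) ->
  (forall i, (i < N)%N -> forall c, y i (z i c) = z i (y i c) + c) ->
  gr H p x ->
  anticomm y z x = \sum_(i < N) kmap (z i \o y i) x + (N%:Z - p)%:~R *: x.
Proof.
move=> sH; elim: N p x => [|N IHN] p x yz yzi xp.
  rewrite big_ord0 /anticomm /= addr0 add0r.
  by move: xp => /=; case: eqP => [-> _|_ ->]; rewrite ?scale0r ?scaler0.
rewrite anticommS => [|i j iN jN ij]; last exact: yz.
have yz' i j : (i < N)%N -> (j < N)%N -> i != j ->
    forall c, y i (z j c) = z j (y i c).
  by move=> iN jN; apply: yz; apply: ltnW.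
have yzi' i : (i < N)%N -> forall c, y i (z i c) = z i (y i c) + c.
  by move=> iN; apply: yzi; apply: ltnW.
case: xp => x1 x2; rewrite (IHN p) // (IHN (p - 1) x.2) //.
rewrite big_ord_recr /= [in RHS](surjective_pairing (\sum_(i < N) _)).
rewrite !(big_morph fst (id1 := 0) (op1 := +%R)) //.
rewrite !(big_morph snd (id1 := 0) (op1 := +%R)) //.
congr pair; rewrite /=; last first.
  rewrite -!addrA; congr (_ + _); rewrite addrC; congr (_ + _ *: _).
  by rewrite intS opprB addrCA addrA.
rewrite -!addrA; congr (_ + _).
rewrite (@eq_kmap _ _ _ (fun c => (z N \o y N) c + idfun c)) => [|c /=]; last exact: yzi.
rewrite (kmapD (z N \o y N)) /= kmap_id addrCA; congr (_ + _).
rewrite -[X in _ + X]scale1r -scalerDl; congr (_ *: _).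
by rewrite -[1]/(1%:~R) -rmorphD /= [in RHS]intS addrC addrA.
Qed.

Lemma kmap_sum M' K (f : nat -> {linear M -> M'}) N (x : kos M N) :
  \sum_(i < K) kmap (f i) x = kmap (fun c => \sum_(i < K) f i c) x.
Proof.
elim: N x => [|N IHN] x //=; rewrite -!IHN.
rewrite [LHS](surjective_pairing (\sum_(i < K) _)).
rewrite !(big_morph fst (id1 := 0) (op1 := +%R)) //.
by rewrite !(big_morph snd (id1 := 0) (op1 := +%R)).
Qed.

Lemma eq_kmap_gr M' (f g : M -> M') H N p (x : kos M N) :
  f 0 = g 0 -> (forall c, H c -> f c = g c) -> gr H p x -> kmap f x = kmap g x.
Proof.
move=> fg0 fg; elim: N p x => [|N IHN] p x /=; last first.
  by case=> /IHN -> /IHN ->.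
by case: eqP => [_ /fg //|_ ->].
Qed.

Lemma kmap_scale a N (x : kos M N) : kmap ( *:%R a) x = a *: x.
Proof. by elim: N x => [|N IHN] //= -[x1 x2]; rewrite !IHN. Qed.
End Gr.

Section EulerExact.
Variables (M : lmodType C) (H : int -> M -> Prop) (z y : nat -> {linear M -> M}).
Variable N : nat.
Hypotheses (sH : forall k, subspace (H k))
  (yH : forall i, (i < N)%N -> forall k c, H k c -> H (k - 1) (y i c))
  (yz : forall i j, (i < N)%N -> (j < N)%N -> i != j ->
     forall c, y i (z j c) = z j (y i c))
  (yzi : forall i, (i < N)%N -> forall c, y i (z i c) = z i (y i c) + c)
  (euler : forall k c, H k c -> \sum_(i < N) z i (y i c) = k%:~R *: c).

(** The divergence is a homotopy: on the kernel of [ek z], its composite with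
    [ek z] multiplies by the integer k + N - p. *)
Lemma ek_exact k p (x : kos M N) : ((k + N%:Z - p)%:~R : C) != 0 ->
  gr (H k) p x -> ek z x = 0 ->
  exists2 w, gr (H (k - 1)) (p - 1) w & x = ek z w.
Proof.
move=> nz xp zx0; have := anticomm_div (sH k) yz yzi xp.
rewrite /anticomm zx0 linear0 add0r => E.
have {}E : ek z (dk y x) = (k + N%:Z - p)%:~R *: x.
  rewrite {}E -[k + N%:Z - p]addrA (rmorphD _ k) /= scalerDl; congr (_ + _).
  rewrite (kmap_sum _ (fun i => z i \o y i)) -kmap_scale.
  apply: eq_kmap_gr xp; last by move=> c /euler.
  by rewrite scaler0 big1 // => i _ /=; rewrite !linear0.
exists (((k + N%:Z - p)%:~R)^-1 *: dk y x); last first.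
  by rewrite linearZ /= E scalerK.
apply: (subspaceZ _ (subspace_gr _ _ (sH _))).
by apply: gr_dk xp => // i c iN; exact: yH.
Qed.
End EulerExact.

(** Exterior degrees 0 and 1: [kconst] and [kvec] embed scalars and vectors,
    [kcst] and [kcoord] read them off. *)
Section LowDegree.
Variable M : lmodType C.

Fixpoint kconst N (c : M) : kos M N :=
  if N is N'.+1 then (kconst N' c, 0) else c.

Fixpoint kcst N : kos M N -> M :=
  if N is N'.+1 then fun x => kcst x.1 else id.

Fixpoint kcoord N (i : nat) : kos M N -> M :=
  if N is N'.+1 then fun x => if i == N' then kcst x.2 else kcoord i x.1
  else fun=> 0.

Fixpoint kvec N (v : nat -> M) : kos M N :=
  if N is N'.+1 then (kvec N' v, kconst N' (v N')) else 0.

Fact kconst_is_linear N : linear (@kconst N).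
Proof.
elim: N => [|N IHN] a b c //=; rewrite IHN; congr pair.
by rewrite /= scaler0 addr0.
Qed.
HB.instance Definition _ N :=
  GRing.isLinear.Build C M (kos M N) *:%R (@kconst N) (@kconst_is_linear N).

Fact kcst_is_linear N : linear (@kcst N).
Proof. by elim: N => [|N IHN] a b c //=; rewrite IHN. Qed.
HB.instance Definition _ N :=
  GRing.isLinear.Build C (kos M N) M *:%R (@kcst N) (@kcst_is_linear N).

Fact kcoord_is_linear N i : linear (@kcoord N i).
Proof.
elim: N => [|N IHN] a b c /=; first by rewrite scaler0 addr0.
by case: ifP => _; rewrite ?IHN ?linearP.
Qed.
HB.instance Definition _ N i :=
  GRing.isLinear.Build C (kos M N) M *:%R (@kcoord N i) (@kcoord_is_linear N i).

Lemma kconstK N : cancel (@kconst N) (@kcst N).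
Proof. by elim: N => [|N IHN] c //=. Qed.

Lemma gr_kconst (H : M -> Prop) N c : subspace H -> H c -> gr H 0 (kconst N c).
Proof.
move=> sH Hc; elim: N => [|N IHN] //=; split=> //.
by have [] := subspace_gr N (0 - 1) sH.
Qed.

Lemma gr0_kconst (H : M -> Prop) N (x : kos M N) :
  gr H 0 x -> H (kcst x) /\ x = kconst N (kcst x).
Proof.
elim: N x => [|N IHN] //= -[x1 x2] /= [/IHN[Hx x1E] x20].
by rewrite -x1E (gr_lt0 _ x20).
Qed.

Lemma eq_kvec N v v' : (forall i, (i < N)%N -> v i = v' i) -> kvec N v = kvec N v'.
Proof.
elim: N => [|N IHN] vv' //=; rewrite vv' // IHN // => i iN.
by rewrite vv' // ltnW.
Qed.

Lemma gr_kvec (H : M -> Prop) N v : subspace H ->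
  (forall i, (i < N)%N -> H (v i)) -> gr H 1 (kvec N v).
Proof.
move=> sH; elim: N => [|N IHN] Hv //=; split.
  by apply: IHN => i iN; apply: Hv; apply: ltnW.
by rewrite subrr; apply: gr_kconst => //; apply: Hv.
Qed.

Lemma gr1_kvec (H : M -> Prop) N (x : kos M N) : gr H 1 x ->
  (forall i, (i < N)%N -> H (kcoord i x)) /\ x = kvec N (fun i => kcoord i x).
Proof.
elim: N x => [|N IHN] //= -[x1 x2] /= [/IHN[Hx x1E]].
rewrite subrr => /gr0_kconst[Hx2 x2E]; split=> [i|].
  by rewrite ltnS leq_eqVlt; case: eqP => //= _; exact: Hx.
rewrite eqxx -x2E; congr pair; rewrite {1}x1E; apply: eq_kvec => i iN.
by rewrite ltn_eqF.
Qed.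

Lemma kcoord_kvec N v i : (i < N)%N -> kcoord i (kvec N v) = v i.
Proof.
elim: N => [|N IHN] //=; rewrite ltnS leq_eqVlt.
by case: eqP => [-> _|_ /IHN //]; rewrite kconstK.
Qed.

Lemma kmap_kconst (f : {linear M -> M}) N c :
  kmap f (kconst N c) = kconst N (f c).
Proof. by elim: N => [|N IHN] //=; rewrite IHN linear0. Qed.

Lemma ek_kconst z N c : ek z (kconst N c) = kvec N (z^~ c).
Proof. by elim: N => [|N IHN] //=; rewrite IHN linear0 subr0 kmap_kconst. Qed.

Lemma dk_kconst y N c : dk y (kconst N c) = 0.
Proof. by elim: N => [|N IHN] //=; rewrite IHN !linear0 addr0. Qed.

Lemma dk_kvec y N v : dk y (kvec N v) = kconst N (\sum_(i < N) y i (v i)).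
Proof.
elim: N => [|N IHN] /=; first by rewrite big_ord0.
by rewrite IHN big_ord_recr /= dk_kconst oppr0 linearD kmap_kconst.
Qed.
End LowDegree.
End Maps.

(** * Homogeneous polynomials *)

Section Homog.
Variables (C : fieldType) (n : nat).
Local Notation S := {mpoly C[n]}.
Implicit Types p q : S.

(** Degrees are integers: the degrees that occur in the zigzags below decrease,
    and a polynomial that is homogeneous of negative degree is 0. *)
Definition ihomog (k : int) p := forall mm, mm \in msupp p -> (mdeg mm)%:Z = k.

Lemma subspace_ihomog k : subspace (ihomog k).
Proof.
split=> [mm|a p q hp hq mm]; first by rewrite msupp0.
by move=> /msuppD_le; rewrite mem_cat => /orP[/msuppZ_le/hp|/hq].
Qed.

Lemma ihomog_lt0 k p : k < 0 -> ihomog k p -> p = 0.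
Proof.
move=> k0 hp; apply/eqP; rewrite -msupp_eq0; case E: (msupp p) => [//|m s].
by have := hp m; rewrite E mem_head => /(_ isT) mk; rewrite -mk in k0.
Qed.

Lemma ihomogM j k p q : ihomog j p -> ihomog k q -> ihomog (j + k) (p * q).
Proof.
move=> hp hq mm /msuppM_le /allpairsP[[m1 m2] /= [/hp <- /hq <- ->]].
by rewrite mdegD PoszD.
Qed.

Lemma ihomogX (mm : 'X_{1..n}) : ihomog (mdeg mm) 'X_[mm].
Proof. by move=> m; rewrite msuppX inE => /eqP->. Qed.

Lemma ihomogXU i : ihomog 1 'X_i.
Proof. by have := @ihomogX U_(i)%MM; rewrite mdeg1. Qed.

Lemma ihomogXn k p d : ihomog k p -> ihomog (k * d%:Z) (p ^+ d).
Proof.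
move=> hp; elim: d => [|d IHd].
  by rewrite mulr0 expr0 => m; rewrite msupp1 inE => /eqP->; rewrite mdeg0.
by rewrite exprS intS mulrDr mulr1; apply: ihomogM.
Qed.

Lemma ihomogC c : ihomog 0 (c%:MP : S).
Proof. by move=> m; rewrite msuppC; case: eqP => // _; rewrite inE => /eqP->; rewrite mdeg0. Qed.

Lemma ihomog_deriv i k p : ihomog k p -> ihomog (k - 1) (mderiv i p).
Proof.
move=> hp mm; rewrite mcoeff_msupp mcoeff_deriv => h.
have /hp : (mm + U_(i))%MM \in msupp p.
  by rewrite mcoeff_msupp; apply: contraNneq h => ->; rewrite mul0rn.
by rewrite mdegD mdeg1 => <-; rewrite PoszD addrK.
Qed.

Lemma ihomogE (d : nat) p : ihomog d p <-> p \is d.-homog.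
Proof.
split=> [hp|/dhomogP hp mm /hp ->//].
by apply/dhomogP => mm /hp; case.
Qed.

Definition prj (k : int) p : S := if k is Posz d then pihomog mdeg d p else 0.

Lemma prj_ihomog k p : ihomog k (prj k p).
Proof.
case: k => d /=; last by case: (subspace_ihomog (Negz d)).
by apply/ihomogE; exact: pihomogP.
Qed.

Fact prj_is_linear k : linear (prj k).
Proof. by case: k => d a p q /=; rewrite ?linearP // scaler0 addr0. Qed.
HB.instance Definition _ k := GRing.isLinear.Build C S S *:%R (prj k)
  (prj_is_linear k).

Lemma prj_id k p : ihomog k p -> prj k p = p.
Proof.
case: k => d hp /=; last by rewrite (ihomog_lt0 _ hp).
by rewrite pihomog_dE //; apply/ihomogE.
Qed.

Lemma prj_neq j k p : ihomog j p -> j != k -> prj k p = 0.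
Proof.
case: j => [j|j] hp; last by rewrite (ihomog_lt0 _ hp) ?linear0.
case: k => // k jk /=; apply: (@pihomog_ne0 _ _ _ j).
  by apply: contraNneq jk => ->.
exact/ihomogE.
Qed.

Lemma prj_sum p : p = \sum_(d < msize p) prj d p.
Proof. exact: pihomog_partitionE (leqnn _). Qed.

Lemma prjM j k p q : ihomog j p -> prj k (p * q) = p * prj (k - j) q.
Proof.
move=> hp; rewrite [q]prj_sum mulr_sumr !linear_sum /= mulr_sumr.
apply: eq_bigr => d _; have hq := @prj_ihomog d q.
have hpq := ihomogM hp hq; case: (eqVneq (d : int) (k - j)) => [dkj|dkj].
  by rewrite -dkj (prj_id hq) prj_id // -[k](subrK j) -dkj addrC.
rewrite (prj_neq hq dkj) mulr0 (prj_neq hpq) //.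
by apply: contraNneq dkj => <-; rewrite addrAC subrr add0r.
Qed.

Lemma euler_homog k p : ihomog k p ->
  \sum_(i < n) 'X_i * mderiv i p = k%:~R *: p.
Proof.
move=> hp.
have E m : \sum_(i < n) 'X_i * mderiv i ('X_[m] : S) = (mdeg m)%:R *: 'X_[m].
  rewrite mdegE natr_sum scaler_suml; apply: eq_bigr => i _.
  rewrite mderivX -scalerAr -mpolyXD; case: (posnP (m i)) => [->|mi].
    by rewrite !scale0r.
  by rewrite addmC submK // lep1mP -lt0n.
rewrite [p in LHS]mpolyE.
under eq_bigr do rewrite linear_sum mulr_sumr.
rewrite exchange_big /= [in RHS](mpolyE p) scaler_sumr.
apply: eq_big_seq => m /hp mk.
under eq_bigr do rewrite linearZ -scalerAr.
by rewrite -scaler_sumr E -mk scalerA mulrC -scalerA.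
Qed.

Lemma meval_homog k p (t : C) x : t != 0 -> ihomog k p ->
  p.@[fun i => t * x i] = t ^ k * p.@[x].
Proof.
move=> t0 hp; rewrite !mevalE mulr_sumr; apply: eq_big_seq => m /hp <-.
rewrite mulrCA; congr (_ * _).
rewrite -exprnP mdegE -prodrXr -big_split /=.
by apply: eq_bigr => i _; rewrite exprMn.
Qed.
End Homog.

(** * Exactness of the wedge product with the Euler field *)

Lemma poly_eq0_horner (C : numFieldType) (q : {poly C}) :
  (forall t, q.[t] = 0) -> q = 0.
Proof.
move=> q0; apply/eqP; apply: contraT => nz.
have := @max_poly_roots _ q [seq (i%:R : C) | i <- iota 0 (size q)] nz.
rewrite size_map size_iota ltnn; apply.
  by apply/allP => t _; apply/rootP.
by rewrite map_inj_uniq ?iota_uniq // => i j /eqP; rewrite eqr_nat => /eqP.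
Qed.

(** Uniqueness of the expansion in base B. *)
Lemma digits_inj B n (a b : nat -> nat) :
  (forall i, (i < n)%N -> (a i < B)%N /\ (b i < B)%N) ->
  (\sum_(i < n) a i * B ^ i = \sum_(i < n) b i * B ^ i)%N ->
  forall i, (i < n)%N -> a i = b i.
Proof.
elim: n a b => [|n IHn] a b ab //.
rewrite !big_ord_recl !expn0 !muln1.
have E (c : nat -> nat) : (\sum_(i < n) c (bump 0 i) * B ^ bump 0 i =
    B * \sum_(i < n) c i.+1 * B ^ i)%N.
  by rewrite big_distrr /=; apply: eq_bigr => i _; rewrite /bump /= add1n expnS mulnCA.
rewrite /= !E => eq_sum; have [a0 b0] := ab 0%N isT.
have B0 : (0 < B)%N by apply: leq_ltn_trans a0.
have e0 : a 0%N = b 0%N.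
  have := congr1 (modn^~ B) eq_sum.
  by rewrite /= ![(_ + B * _)%N]addnC ![(B * _)%N]mulnC !modnMDl !modn_small.
have e1 : (\sum_(i < n) a i.+1 * B ^ i = \sum_(i < n) b i.+1 * B ^ i)%N.
  by move: eq_sum; rewrite e0 => /addnI /eqP; rewrite eqn_pmul2l // => /eqP.
case=> [//|i]; rewrite ltnS; apply: (IHn (a \o succn) (b \o succn)) => // j jn.
exact: ab.
Qed.

(** Kronecker's substitution z_i = t^(B^i), with B larger than all exponents,
    separates the monomials, and so reduces the claim to one variable. *)
Lemma mpoly_eq0_meval (C : numFieldType) n (p : {mpoly C[n]}) :
  (forall x, p.@[x] = 0) -> p = 0.
Proof.
move=> p0; pose B := msize p; pose kap (m : 'X_{1..n}) := (\sum_(i < n) m i * B ^ i)%N.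
pose q : {poly C} := \sum_(m <- msupp p) p@_m *: 'X^(kap m).
have q0 : q = 0.
  apply: poly_eq0_horner => t; rewrite -[RHS](p0 (fun i => t ^+ (B ^ i))) mevalE.
  rewrite /q horner_sum; apply: eq_bigr => m _.
  rewrite hornerZ hornerXn -prodrXr; congr (_ * _); apply: eq_bigr => i _.
  by rewrite -exprM mulnC.
have lt_B m i : m \in msupp p -> (m i < B)%N.
  move=> /msize_mdeg_lt; apply: leq_ltn_trans.
  by rewrite mdegE (bigD1 i) //= leq_addr.
have inj_kap : {in msupp p &, injective kap}.
  move=> m1 m2 h1 h2 eq_kap; apply/mnmP => i.
  pose a (m : 'X_{1..n}) j := if insub j is Some l then m (l : 'I_n) else 0%N.
  have aE m (l : 'I_n) : a m l = m l by rewrite /a valK.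
  rewrite -!aE; apply: (@digits_inj B n) => [j jn||//].
    by rewrite -[j]/(val (Ordinal jn)) !aE !lt_B.
  by under eq_bigr do rewrite aE; under [RHS]eq_bigr do rewrite aE.
apply/eqP; rewrite -msupp_eq0; case E: (msupp p) => [//|m s].
have mp : m \in msupp p by rewrite E mem_head.
have := congr1 (coefp (kap m)) q0; rewrite raddf0 raddf_sum /= (bigD1_seq m) //=.
rewrite coefZ coefXn eqxx mulr1 big1_seq ?addr0 => [|j /andP[jm jp]].
  by move/eqP; rewrite mcoeff_eq0 mp.
rewrite /= coefZ coefXn; case: eqP => [/inj_kap ji|]; last by rewrite mulr0.
by rewrite ji ?eqxx // in jm.
Qed.

Section MulOp.
Variables (C : fieldType) (n : nat).
Local Notation S := {mpoly C[n.+1]}.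

Definition mulop (s : S) (p : S) := s * p.
Fact mulop_is_linear s : linear (mulop s).
Proof. by move=> a p q; rewrite /mulop mulrDr scalerAr. Qed.
HB.instance Definition _ s := GRing.isLinear.Build C S S *:%R (mulop s)
  (mulop_is_linear s).

Definition zop (i : nat) : {linear S -> S} := mulop 'X_(inord i).
Definition pop (i : nat) : {linear S -> S} := mderiv (inord i).

Lemma mulopC s t c : mulop s (mulop t c) = mulop t (mulop s c).
Proof. exact: mulrCA. Qed.

Lemma ihomog_mulop s j k p : ihomog j s -> ihomog k p -> ihomog (k + j) (mulop s p).
Proof. by move=> hs hp; rewrite addrC; apply: ihomogM. Qed.

End MulOp.

Section ZExact.
Variables (C : numFieldType) (n : nat).
Local Notation S := {mpoly C[n.+1]}.

(** Since k + N - p is nonnegative whenever there is a nonzero x, it vanishes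
    for the constants of top exterior degree only. *)
Lemma ekz_exact k p (x : kos S n.+1) : ~ (k = 0 /\ p = n.+1%:Z) ->
  gr (@ihomog C n.+1 k) p x -> ek (@zop C n) x = 0 ->
  exists2 w, gr (@ihomog C n.+1 (k - 1)) (p - 1) w & x = ek (@zop C n) w.
Proof.
move=> nkp xp zx0.
have [k0|k0] := ltP k 0.
  exists 0; first by have [] := subspace_gr n.+1 (p - 1) (@subspace_ihomog C n.+1 (k - 1)).
  have kmap0 N (u : kos S N) : kmap (fun=> 0 : S) u = 0.
    by elim: N u => [|N IHN] //= u; rewrite !IHN.
  by rewrite linear0 (kmap_eq0 _ xp (kmap0 _ _)) // => c /(ihomog_lt0 k0).
have [pn|pn] := ltP n.+1%:Z p.
  exists 0; last by rewrite linear0; apply: gr_gtN xp.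
  by have [] := subspace_gr n.+1 (p - 1) (@subspace_ihomog C n.+1 (k - 1)).
apply: (@ek_exact _ _ (@ihomog C n.+1) _ (@pop C n)) zx0 => //.
- exact: subspace_ihomog.
- by move=> i _ j c; apply: ihomog_deriv.
- move=> i j iN jN ij c; rewrite /zop /pop /= /mulop mderivM mderivX mnm1E.
  have -> : (inord j == inord i :> 'I_n.+1) = false.
    by apply: contraNF ij => /eqP/(congr1 val); rewrite /= !inordK // => ->.
  by rewrite scale0r mul0r add0r.
- move=> i iN c; rewrite /zop /pop /= /mulop mderivM mderivX mnm1E eqxx scale1r.
  have -> : (U_(inord i) - U_(inord i) = 0 :> 'X_{1..n.+1})%MM.
    by apply/mnmP => l; rewrite mnmBE subnn mnm0E.
  by rewrite mpolyX0 mul1r addrC.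
- move=> j c hc; rewrite -(euler_homog hc); apply: eq_bigr => i _.
  by rewrite /zop /pop /= inord_val.
rewrite intr_eq0; apply: contra_notN nkp => /eqP E; split; lia.
Qed.
End ZExact.

(** * Depth sensitivity of the Koszul complex *)

Section KosMore.
Variable C : fieldType.

Lemma gr_ker (M M' : lmodType C) (f : M -> M') (H : M -> Prop) N p (x : kos M N) :
  gr H p x -> kmap f x = 0 -> gr (fun c => H c /\ f c = 0) p x.
Proof.
elim: N p x => [|N IHN] p x /=; first by case: ifP.
by case=> h1 h2 [e1 e2]; split; apply: IHN.
Qed.

Lemma eq_dk (M : lmodType C) (y y' : nat -> {linear M -> M}) N (x : kos M N) :
  (forall i, (i < N)%N -> y i =1 y' i) -> dk y x = dk y' x.
Proof.
elim: N x => [|N IHN] x yy' //=.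
by rewrite !IHN ?(eq_kmap _ (yy' N _)) // => i iN; apply/yy'/ltnW.
Qed.

Lemma gr_eq0 (M : lmodType C) (H : M -> Prop) N p (x : kos M N) :
  (forall c, H c -> c = 0) -> gr H p x -> x = 0.
Proof.
move=> H0; elim: N p x => [|N IHN] p x /=; first by case: ifP => // _ /H0.
by case: x => x1 x2 /= [/IHN-> /IHN->].
Qed.

(** The vector c e_i. *)
Fixpoint kunit (M : lmodType C) N (i : nat) : M -> kos M N :=
  if N is N'.+1 then
    fun c => if i == N' then (0, kconst N' c) else (kunit N' i c, 0)
  else fun=> 0.

Fact kunit_is_linear (M : lmodType C) N i : linear (@kunit M N i).
Proof.
elim: N => [|N IHN] a b c /=; first by rewrite scaler0 addr0.
by case: ifP => _; rewrite ?IHN ?linearP; congr pair; rewrite /= scaler0 addr0.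
Qed.
HB.instance Definition _ (M : lmodType C) N i :=
  GRing.isLinear.Build C M (kos M N) *:%R (@kunit M N i) (@kunit_is_linear M N i).

Lemma gr_kunit (M : lmodType C) (H : M -> Prop) N i c :
  subspace H -> H c -> gr H 1 (kunit N i c).
Proof.
move=> sH Hc; elim: N => [|N IHN] //=; case: ifP => _ /=; split=> //.
- by have [] := subspace_gr N 1 sH.
- by rewrite subrr; apply: gr_kconst.
- by have [] := subspace_gr N (1 - 1) sH.
Qed.

Lemma kmap_kunit (M : lmodType C) (f : {linear M -> M}) N i c :
  kmap f (kunit N i c) = kunit N i (f c).
Proof.
elim: N => [|N IHN] //=; first by rewrite linear0.
by case: ifP => _ /=; rewrite ?linear0 ?kmap_kconst ?IHN.
Qed.

Lemma kcst_kmap (M : lmodType C) (f : M -> M) N (x : kos M N) :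
  kcst (kmap f x) = f (kcst x).
Proof. by elim: N x => [|N IHN] x //=. Qed.

Lemma kvec_sum (M : lmodType C) N v : kvec N v = \sum_(i < N) @kunit M N i (v i).
Proof.
elim: N => [|N IHN] /=; first by rewrite big_ord0.
rewrite big_ord_recr /= eqxx IHN.
rewrite [RHS](surjective_pairing (\sum_(i < N) _ + _)) /=.
rewrite !(big_morph fst (id1 := 0) (op1 := +%R)) //.
rewrite !(big_morph snd (id1 := 0) (op1 := +%R)) //= addr0.
congr pair; last first.
  by rewrite big1 ?add0r // => i _; rewrite ltn_eqF.
by apply: eq_bigr => i _; rewrite ltn_eqF.
Qed.

Lemma kmap_kvec_units (M : lmodType C) (f : nat -> {linear M -> M}) N r (x : kos M r) :
  kmap (fun c => kvec N (f^~ c)) x = \sum_(i < N) kmap (@kunit M N i) (kmap (f i) x).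
Proof.
under eq_bigr do rewrite kmap_comp.
rewrite (kmap_sum N (fun i => @kunit M N i \o f i)).
by apply: eq_kmap => c /=; rewrite kvec_sum.
Qed.

(** Exactness in exterior degree p of the Koszul complex of r elements of degree
    delta, in every polynomial degree. *)
Definition exact_at (M : lmodType C) (H : int -> M -> Prop)
    (y : nat -> {linear M -> M}) (delta : int) r (p : int) :=
  forall k (x : kos M r), gr (H k) p x -> dk y x = 0 ->
  exists2 w, gr (H (k - delta)) (p + 1) w & x = dk y w.

Lemma exact_at_dsum (M M1 M2 : lmodType C)
   (H : int -> M -> Prop) (H1 : int -> M1 -> Prop) (H2 : int -> M2 -> Prop)
   (y : nat -> {linear M -> M}) (y1 : nat -> {linear M1 -> M1})
   (y2 : nat -> {linear M2 -> M2})
   (f1 : {linear M -> M1}) (f2 : {linear M -> M2})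
   (g1 : {linear M1 -> M}) (g2 : {linear M2 -> M}) delta r p :
  (forall k, subspace (H k)) ->
  (forall c, c = g1 (f1 c) + g2 (f2 c)) ->
  (forall k c, H k c -> H1 k (f1 c)) -> (forall k c, H k c -> H2 k (f2 c)) ->
  (forall k c, H1 k c -> H k (g1 c)) -> (forall k c, H2 k c -> H k (g2 c)) ->
  (forall i c, f1 (y i c) = y1 i (f1 c)) ->
  (forall i c, f2 (y i c) = y2 i (f2 c)) ->
  (forall i c, g1 (y1 i c) = y i (g1 c)) ->
  (forall i c, g2 (y2 i c) = y i (g2 c)) ->
  exact_at H1 y1 delta r p -> exact_at H2 y2 delta r p ->
  exact_at H y delta r p.
Proof.
move=> sH gf Hf1 Hf2 Hg1 Hg2 f1y f2y g1y g2y ex1 ex2 k x xp dx.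
have [|w1 hw1 e1] := ex1 _ _ (gr_kmap (Hf1 k) xp).
  by rewrite -(@kmap_dk _ _ _ _ y) ?dx ?linear0.
have [|w2 hw2 e2] := ex2 _ _ (gr_kmap (Hf2 k) xp).
  by rewrite -(@kmap_dk _ _ _ _ y) ?dx ?linear0.
exists (kmap g1 w1 + kmap g2 w2).
  by apply: (subspaceD (subspace_gr _ _ (sH _))); apply: gr_kmap hw1 || apply: gr_kmap hw2; auto.
rewrite linearD /= -(@kmap_dk _ _ _ _ y1) // -(@kmap_dk _ _ _ _ y2) //= -e1 -e2.
rewrite !kmap_comp -(kmapD (g1 \o f1) (g2 \o f2)) -[LHS]kmap_id.
by apply: eq_kmap => c /=; exact: gf.
Qed.
End KosMore.

Section Depth.
Variables (C : numFieldType) (n : nat).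
Local Notation S := {mpoly C[n.+1]}.
Local Notation N := n.+1.
Local Notation ihom := (@ihomog C N).
Local Notation Z := (@zop C n).

Definition yop (y : nat -> S) i : {linear S -> S} := mulop (y i).
Definition yopk (y : nat -> S) K i : {linear kos S K -> kos S K} := @kmap C S S (yop y i) K.

Lemma yopkC y K i l c : yopk y K i (yopk y K l c) = yopk y K l (yopk y K i c).
Proof. by rewrite /= !kmap_comp; apply: eq_kmap => b; rewrite /= mulopC. Qed.

Fact inl_linear (K : nat) : linear (fun c : kos S K => (c, 0) : kos S K.+1).
Proof. by move=> a b c; congr pair; rewrite /= scaler0 addr0. Qed.
Fact inr_linear (K : nat) : linear (fun c : kos S K => (0, c) : kos S K.+1).
Proof. by move=> a b c; congr pair; rewrite /= scaler0 addr0. Qed.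
Definition kinl (K : nat) (c : kos S K) : kos S K.+1 := (c, 0).
Definition kinr (K : nat) (c : kos S K) : kos S K.+1 := (0, c).
HB.instance Definition _ K := GRing.isLinear.Build C (kos S K) (kos S K.+1) *:%R
  (@kinl K) (@inl_linear K).
HB.instance Definition _ K := GRing.isLinear.Build C (kos S K) (kos S K.+1) *:%R
  (@kinr K) (@inr_linear K).
Definition kfst (K : nat) (c : kos S K.+1) : kos S K := c.1.
Definition ksnd (K : nat) (c : kos S K.+1) : kos S K := c.2.
HB.instance Definition _ K := GRing.isLinear.Build C (kos S K.+1) (kos S K) *:%R
  (@kfst K) (fun _ _ _ => erefl).
HB.instance Definition _ K := GRing.isLinear.Build C (kos S K.+1) (kos S K) *:%R
  (@ksnd K) (fun _ _ _ => erefl).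

(** The exterior algebra of S^K is a free S-module, so that Koszul exactness
    passes from S to its coefficients. *)
Lemma exact_at_kos y delta r p : exact_at ihom (yop y) delta r p ->
  forall K j, exact_at (fun k => @gr C S (ihom k) K j) (yopk y K) delta r p.
Proof.
move=> ex; elim=> [|K IHK] j.
  move=> k x /=; have [_|j0] := eqVneq j 0.
    by rewrite (@eq_dk _ _ _ (yop y)) // => xp /(ex _ _ xp)[w wp ->]; exists w;
      rewrite // (@eq_dk _ _ _ (yop y)).
  move=> xp _; exists 0; last by rewrite linear0; apply: gr_eq0 xp.
  have s0 : subspace (fun c : S => c = 0).
    by split=> // a b c -> ->; rewrite scaler0 addr0.
  exact: (subspace_gr r (p + 1) s0).1.
have sg i k K' : subspace (@gr C S (ihom k) K' i).
  by apply: subspace_gr; exact: subspace_ihomog.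
apply: (@exact_at_dsum _ _ (kos S K) (kos S K) _ _ _ _ (yopk y K) (yopk y K)
  (@kfst K) (@ksnd K) (@kinl K) (@kinr K) delta r p _ _ _ _ _ _ _ _ _ _
  (IHK j) (IHK (j - 1))) => //.
- by move=> [c1 c2]; congr pair; rewrite /= ?addr0 ?add0r.
- by move=> k c [].
- by move=> k c [].
- by move=> k c hc; split=> //; exact: (sg _ _ _).1.
- by move=> k c hc; split=> //; exact: (sg _ _ _).1.
- by move=> i c; rewrite /kinl /kinr /yopk /= linear0.
- by move=> i c; rewrite /kinl /kinr /yopk /= linear0.
Qed.

(** The double complex with differentials d, the contraction with y on the
    outer exterior algebra, and e, the wedge product with z on the coefficients.
    As e is exact on coefficients of degree j < N, Koszul homology that is
    killed by all variables can be moved from exterior degree p to higher and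
    higher exterior degrees, where there is nothing left. *)
Section Chase.
Variables (y : nat -> S) (delta : int) (r : nat).
Hypothesis hy : forall i, (i < r)%N -> ihom delta (y i).

Local Notation MK := (kos S N).
Local Notation H j k := (@gr C S (ihom k) N j).
Local Notation d := (@dk C MK (yopk y N) r).
Local Notation e := (@kmap C MK MK (@ek C S Z N) r).

Let sH j k : subspace (H j k).
Proof. by apply: subspace_gr; exact: subspace_ihomog. Qed.

Let de x : d (e x) = e (d x).
Proof.
rewrite -(@kmap_dk _ _ _ (@ek C S Z N) (yopk y N) (yopk y N)) // => i _ c.
apply/esym; apply: (@kmap_ek _ _ _ (yop y i) Z Z) => l _ c'.
by rewrite /yop /zop /= mulopC.
Qed.

Let ee x : e (e x) = 0.
Proof.
rewrite kmap_comp (@eq_kmap _ _ _ _ (fun=> 0)) => [|c]; last first.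
  rewrite /comp ekek // => i j _ _ b.
  by rewrite /zop /= mulopC.
by elim: (r) x => [|r' IHr] //= x; rewrite !IHr.
Qed.

Lemma gr_dky j k p x : gr (H j (k - delta)) (p + 1) x -> gr (H j k) p (d x).
Proof.
move=> xp; rewrite -[p](addrK 1); apply: gr_dk xp => // i c ir hc.
by apply: gr_kmap hc => b hb; rewrite -(subrK delta k); exact: ihomog_mulop (hy ir) hb.
Qed.

Lemma gr_e j k p x : gr (H j k) p x -> gr (H (j + 1) (k + 1)) p (e x).
Proof.
apply: gr_kmap => c; apply: gr_ek; first exact: subspace_ihomog.
by move=> i b _ hb; exact: ihomog_mulop (@ihomogXU _ _ _) hb.
Qed.

Variable p : int.
Hypothesis rp : r%:Z - N%:Z < p.
Hypothesis ex : forall q, p < q -> exact_at ihom (yop y) delta r q.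

(** Induction from the top: e x' is a d-boundary because d is exact above p; the
    induction hypothesis for x' then corrects x by the boundary d v into an
    element of the kernel of e. *)
Lemma chase t (j : nat) k x x' : p + j%:Z + t%:Z = r%:Z + 1 ->
  gr (H j k) (p + j%:Z) x ->
  gr (H (j%:Z + 1) (k + 1 - delta)) (p + j%:Z + 1) x' -> e x = d x' ->
  exists u v, [/\ gr (H j (k - delta)) (p + j%:Z + 1) u,
    gr (H (j%:Z - 1) (k - 1)) (p + j%:Z) v & x = d u + e v].
Proof.
elim: t j k x x' => [|t IHt] j k x x' pjt xp x'p exd.
  exists 0, 0; split; try exact: (subspace_gr _ _ (sH _ _)).1.
  by rewrite !linear0 addr0; apply: gr_gtN xp; lia.
have dex' : d (e x') = 0 by rewrite de -exd ee.
have ex'p := gr_e x'p.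
have p_lt : p < p + j%:Z + 1 by lia.
have [x'' x''p ex''] := exact_at_kos (ex p_lt) ex'p dex'.
have jS : j.+1%:Z = j%:Z + 1 by lia.
have pj : p + j%:Z + 1 = p + j.+1%:Z by lia.
have pjt' : p + j.+1%:Z + t%:Z = r%:Z + 1 by lia.
rewrite -jS pj in x'p; rewrite -jS pj in x''p.
have [u [v [up vp x'E]]] := IHt _ _ _ _ pjt' x'p x''p ex''.
have vp' : gr (H j (k - delta)) (p + j%:Z + 1) v.
  have kd : k + 1 - delta - 1 = k - delta by lia.
  have jj : j.+1%:Z - 1 = j%:Z by lia.
  by move: vp; rewrite pj kd jj.
have dd : d (d u) = 0.
  by rewrite dkdk // => i l _ _ c; exact: yopkC.
have exv : e (x - d v) = 0.
  by rewrite linearB /= -de exd x'E linearD /= dd add0r subrr.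
have xvp : gr (H j k) (p + j%:Z) (x - d v).
  by apply: (subspaceB (subspace_gr _ _ (sH _ _))) => //; apply: gr_dky.
have [w wp xE] : exists2 w, gr (H (j%:Z - 1) (k - 1)) (p + j%:Z) w & x - d v = e w.
  apply: kmap_lift (gr_ker xvp exv) => c [hc c0].
  by apply: ekz_exact c0 => //; lia.
by exists v, w; split=> //; rewrite -xE addrC subrK.
Qed.

(** A cycle x with all z_i x boundaries: e x, the sum of the z_i x e_i, is then a
    boundary in the double complex, and the zigzag applies with j = 0, where
    there is no room for the term e v. *)
Lemma exact_socle k (x : kos S r) : gr (ihom k) p x -> dk (yop y) x = 0 ->
  (forall i : 'I_N, exists2 w, gr (ihom (k + 1 - delta)) (p + 1) w &
     kmap (Z i) x = dk (yop y) w) ->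
  exists2 w, gr (ihom (k - delta)) (p + 1) w & x = dk (yop y) w.
Proof.
move=> xp dx /fin_all_exists2[w wp wE].
pose x0 : kos MK r := kmap (@kconst C S N) x.
pose x' : kos MK r := \sum_(i < N) kmap (@kunit C S N i) (w i).
have x0p : gr (H 0 k) p x0.
  by apply: gr_kmap xp => c; apply: gr_kconst; exact: subspace_ihomog.
have x'p : gr (H 1 (k + 1 - delta)) (p + 1) x'.
  rewrite /x'; elim/big_ind: _ => [|a b ha hb|i _].
  - exact: (subspace_gr _ _ (sH _ _)).1.
  - exact: (subspaceD (subspace_gr _ _ (sH _ _))).
  by apply: gr_kmap (wp i) => c; apply: gr_kunit; exact: subspace_ihomog.
have ex0 : e x0 = d x'.
  rewrite /x' linear_sum /x0 kmap_comp.
  rewrite (@eq_kmap _ _ _ _ (fun c => kvec N (Z^~ c))) => [|c]; last exact: ek_kconst.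
  rewrite kmap_kvec_units; apply: eq_bigr => i _; rewrite wE.
  by apply: kmap_dk => l _ c; apply/esym/kmap_kunit.
have rp0 : p <= r%:Z \/ r%:Z < p by lia.
case: rp0 => [p_le|p_gt]; last first.
  exists 0; first exact: (subspace_gr _ _ (@subspace_ihomog _ _ _)).1.
  by rewrite linear0; apply: gr_gtN xp.
have chart_pt : p + 0%:Z + (absz (r%:Z + 1 - p)%R)%:Z = r%:Z + 1 by lia.
have x0p' : gr (H 0 k) (p + 0%:Z) x0 by rewrite addr0.
have x'p' : gr (H (0%:Z + 1) (k + 1 - delta)) (p + 0%:Z + 1) x' by rewrite addr0 add0r.
have [u [v [up vp x0E]]] := @chase _ 0%N k x0 x' chart_pt x0p' x'p' ex0.
rewrite addr0 in up vp; have v0 : v = 0.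
  by apply: gr_eq0 vp => c; apply: gr_lt0.
exists (kmap (@kcst C S N) u).
  by apply: gr_kmap up => c /gr0_kconst[].
rewrite -(@kmap_dk _ _ _ _ (yopk y N)) => [|i _ c]; last exact: kcst_kmap.
have -> : d u = x0 by rewrite x0E v0 linear0 addr0.
rewrite /x0 kmap_comp -[LHS]kmap_id; apply: eq_kmap => c /=.
by rewrite kconstK.
Qed.

(** Induction on the sum of the exponents: z_j x satisfies the hypothesis with
    one exponent lowered, hence is a boundary, for every j. *)
Lemma exact_nilpotent s (mu : 'I_N -> nat) : (\sum_i mu i <= s)%N ->
  forall k (x : kos S r), gr (ihom k) p x -> dk (yop y) x = 0 ->
  (forall i : 'I_N, exists2 w, gr (ihom (k + (mu i)%:Z - delta)) (p + 1) w &
     kmap (mulop ('X_i ^+ mu i)) x = dk (yop y) w) ->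
  exists2 w, gr (ihom (k - delta)) (p + 1) w & x = dk (yop y) w.
Proof.
elim: s mu => [|s IHs] mu le_mu k x xp dx hx.
  have mu0 : mu ord0 = 0%N.
    by apply/eqP; rewrite -leqn0; apply: leq_trans le_mu; rewrite (bigD1 ord0) //= leq_addr.
  have [w] := hx ord0; rewrite mu0 addr0 => wp wE; exists w => //; rewrite -wE.
  by rewrite -[LHS]kmap_id; apply: eq_kmap => c; rewrite /mulop expr0 mul1r.
have [/existsP[i /eqP mui]|] := boolP [exists i, mu i == 0%N].
  have [w] := hx i; rewrite mui addr0 => wp wE; exists w => //; rewrite -wE.
  by rewrite -[LHS]kmap_id; apply: eq_kmap => c; rewrite /mulop expr0 mul1r.
rewrite negb_exists => /forallP mu0; apply: exact_socle => // j.
pose mu' i := (mu i - (i == j))%N.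
have muE i : mu i = (mu' i + (i == j))%N.
  by rewrite subnK //; case: eqP => // _; rewrite lt0n mu0.
have le_mu' : (\sum_i mu' i <= s)%N.
  rewrite -ltnS -addn1; apply: leq_trans le_mu.
  rewrite (eq_bigr _ (fun i _ => muE i)) big_split /= leq_add2l.
  by rewrite (bigD1 j) //= eqxx.
have mulXc a (c : S) (u : kos S r) :
    kmap (mulop a) (kmap (mulop c) u) = kmap (mulop (a * c)) u.
  by rewrite kmap_comp; apply: eq_kmap => b; rewrite /= /mulop mulrA.
have X1 : ihom 1 ('X_j : S) by exact: ihomogXU.
have ZE : Z j =1 mulop ('X_j) by move=> c; rewrite /zop /= inord_val.
have dX (u : kos S r) a : dk (yop y) (kmap (mulop a) u) = kmap (mulop a) (dk (yop y) u).
  by apply/esym/kmap_dk => i _ c; rewrite /yop /= mulopC.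
have grX k' p' (u : kos S r) : gr (ihom k') p' u -> gr (ihom (k' + 1)) p' (kmap (mulop 'X_j) u).
  by apply: gr_kmap => c; exact: ihomog_mulop.
rewrite (eq_kmap _ ZE).
apply: (IHs mu' le_mu' (k + 1)) => [||i]; first exact: grX.
  by rewrite dX dx linear0.
have [w wp wE] := hx i; rewrite mulXc; case: (eqVneq i j) => [ij|ij].
  exists w; last by rewrite -wE muE ij eqxx addn1 exprSr.
  by move: wp; rewrite muE ij eqxx PoszD (addrC _ 1) addrA.
exists (kmap (mulop 'X_j) w).
  by have := grX _ _ _ wp; rewrite muE (negPf ij) addn0 addrAC (addrAC k).
by rewrite dX -wE muE (negPf ij) addn0 mulXc mulrC.
Qed.
End Chase.

(** The elements of the ideal (y) annihilate Koszul homology, the homotopy being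
    the wedge product with the coefficients c; hence so do powers of all
    variables.  The exterior degrees p are treated in decreasing order. *)
Lemma exact_of_powers (y : nat -> S) delta r :
  (forall i, (i < r)%N -> ihom delta (y i)) ->
  (forall i : 'I_N, exists mu (c : nat -> S),
      'X_i ^+ mu = \sum_(l < r) c l * y l) ->
  forall p, r%:Z - N%:Z < p -> exact_at ihom (yop y) delta r p.
Proof.
move=> hy pows p.
have [s] : exists s : nat, r%:Z + 1 - p <= s%:Z.
  by exists (absz (r%:Z + 1 - p)%R); lia.
elim: s p => [|s IHs] p ps rp k x xp dx.
  exists 0; first exact: (subspace_gr _ _ (@subspace_ihomog _ _ _)).1.
  by rewrite linear0; apply: gr_gtN xp; lia.
have [mu hmu] := fin_all_exists pows.
apply: (@exact_nilpotent _ _ _ hy p rp _ _ mu (leqnn _)) => // [q pq|i].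
  by apply: IHs; lia.
have [c cE] := hmu i.
pose c' l := prj ((mu i)%:Z - delta) (c l).
have c'E : 'X_i ^+ mu i = \sum_(l < r) c' l * y l.
  have hX : ihom (mu i) ('X_i ^+ mu i) by rewrite -[(mu i)%:Z]mul1r; apply/ihomogXn/ihomogXU.
  rewrite -(prj_id hX) cE linear_sum /=; apply: eq_bigr => l _.
  by rewrite -[LHS]/(prj (mu i) _) [c l * y l]mulrC (prjM _ _ (hy l (ltn_ord l))) mulrC.
exists (ek (yop c') x).
  apply: gr_ek xp => [|l b lr hb]; first exact: subspace_ihomog.
  by rewrite -addrA; apply: ihomog_mulop hb; exact: prj_ihomog.
have := anticomm_mul (y := yop y) (z := yop c') x.
rewrite /anticomm dx linear0 addr0 => -> => [|l l' _ _ b]; last exact: mulopC.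
rewrite (kmap_sum _ (fun l => yop y l \o yop c' l)); apply: eq_kmap => b.
rewrite /mulop c'E mulr_suml; apply: eq_bigr => l _.
by rewrite /= /yop /= /mulop mulrA (mulrC (y l)).
Qed.

(** The complex of y_0, ..., y_r is the cone of y_r on that of y_0, ...,
    y_(r-1), so that the homology of the latter is divisible by y_r, which has
    positive degree; by induction on the degree it vanishes. *)
Lemma exact_of_cone (a y : nat -> S) delta r p : 0 < delta ->
  ihom delta (y r) -> (forall i, (i < r)%N -> y i = a i) ->
  exact_at ihom (yop y) delta r.+1 p -> exact_at ihom (yop a) delta r p.
Proof.
move=> d0 hyr ya ex.
have dya (u : kos S r) : dk (yop y) u = dk (yop a) u.
  by apply: eq_dk => i ir c; rewrite /yop /= ya.
suff H (s : nat) (k : int) (x : kos S r) : k < s%:Z -> gr (ihom k) p x -> dk (yop a) x = 0 ->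
    exists2 w, gr (ihom (k - delta)) (p + 1) w & x = dk (yop a) w.
  by move=> k x; apply: (H (absz k).+1); lia.
elim: s k x => [|s IHs] k x ks xp dx.
  exists 0; first exact: (subspace_gr _ _ (@subspace_ihomog _ _ _)).1.
  by rewrite linear0; apply: gr_eq0 xp => c; exact: ihomog_lt0.
have [] := ex k (x, 0).
- by split=> //; exact: (subspace_gr _ _ (@subspace_ihomog _ _ _)).1.
- by rewrite /= dya dx !linear0 add0r.
move=> [w0 w1] /= [w0p]; rewrite addrK => w1p [xE w1E].
have dw1 : dk (yop a) w1 = 0 by rewrite -dya; apply/eqP; rewrite -oppr_eq0 -w1E.
have [|v vp vE] := IHs (k - delta) w1 _ w1p dw1; first by lia.
exists (w0 + kmap (mulop (y r)) v).
  apply: (subspaceD (subspace_gr _ _ (@subspace_ihomog _ _ _))) => //.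
  by apply: gr_kmap vp => c hc; rewrite -(subrK delta (k - delta)); exact: ihomog_mulop.
rewrite xE dya linearD; congr (_ + _).
rewrite vE; apply: kmap_dk => i _ c.
by rewrite /yop /= mulopC.
Qed.
End Depth.

(** * The zigzag between contraction and wedge product *)

Section MainChase.
Variables (C : numFieldType) (n : nat).
Local Notation S := {mpoly C[n.+1]}.
Local Notation N := n.+1.
Local Notation ihom := (@ihomog C N).
Local Notation Z := (@zop C n).
Variables (a : nat -> S) (delta : int).
Hypotheses (ha : forall i, (i < N)%N -> ihom delta (a i))
  (az : \sum_(i < N) a i * 'X_i = 0)
  (exa : forall p, 2 <= p -> exact_at ihom (yop a) delta N p).
Local Notation d := (@dk C S (yop a) N).
Local Notation e := (@ek C S Z N).

Lemma da_ez x : d (e x) = - e (d x).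
Proof.
apply/eqP; rewrite -addr_eq0; apply/eqP.
have := @anticomm_mul _ _ (yop a) Z N x.
rewrite /anticomm => -> => [|i j _ _ c]; last exact: mulopC.
rewrite (kmap_sum _ (fun l => yop a l \o Z l)).
have -> : 0 = kmap (fun c : S => 0 *: c) x by rewrite kmap_scale scale0r.
apply: eq_kmap => c; rewrite scale0r.
transitivity ((\sum_(i < N) a i * 'X_i) * c); last by rewrite az mul0r.
by rewrite mulr_suml; apply: eq_bigr => i _; rewrite /yop /zop /= /mulop inord_val mulrA.
Qed.

Lemma ez_ez x : e (e x) = 0.
Proof. by apply: ekek => i j _ _ c; exact: mulopC. Qed.

Let eD u v : e (u + v) = e u + e v. Proof. exact: linearD. Qed.
Let dD u v : d (u + v) = d u + d v. Proof. exact: linearD. Qed.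

Lemma da_da x : d (d x) = 0.
Proof. by apply: dkdk => i j _ _ c; exact: mulopC. Qed.

Lemma gr_da k p x : gr (ihom k) p x -> gr (ihom (k + delta)) (p - 1) (d x).
Proof.
apply: gr_dk; first exact: subspace_ihomog.
by move=> i c iN; apply: ihomog_mulop; exact: ha.
Qed.

Lemma gr_ez k p x : gr (ihom k) p x -> gr (ihom (k + 1)) (p + 1) (e x).
Proof.
apply: gr_ek; first exact: subspace_ihomog.
by move=> i c iN; apply: ihomog_mulop; exact: ihomogXU.
Qed.

Lemma gr_zero k p : gr (ihom k) p (0 : kos S N).
Proof. exact: (subspace_gr _ _ (@subspace_ihomog _ _ _)).1. Qed.

(** One step replaces x by x' with e x = d x', two exterior degrees higher and
    delta - 1 polynomial degrees lower.  The condition on k excludes that the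
    zigzag ends at a constant of exterior degree N, where e is not exact. *)
Lemma double_chase t p k x : N%:Z <= p + 2 * t%:Z -> 1 <= p ->
  (forall s : nat, p + 2 * s%:Z = N%:Z -> k + s%:Z * (1 - delta) <> 0) ->
  gr (ihom k) p x -> d (e x) = 0 ->
  exists u v, [/\ gr (ihom (k - delta)) (p + 1) u,
    gr (ihom (k - 1)) (p - 1) v & x = d u + e v].
Proof.
have top q l u : N%:Z <= q -> (q = N%:Z -> l <> 0) -> gr (ihom l) q u ->
    exists v w, [/\ gr (ihom (l - delta)) (q + 1) v,
      gr (ihom (l - 1)) (q - 1) w & u = d v + e w].
  move=> Nq l0 uq; have [w wp ->] : exists2 w, gr (ihom (l - 1)) (q - 1) w & u = e w.
    apply: (ekz_exact _ uq) => [[l0' qN]|]; first exact: (l0 qN).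
    by apply: gr_gtN (gr_ez uq); lia.
  by exists 0, w; split=> //; rewrite ?linear0 ?add0r //; exact: gr_zero.
elim: t p k x => [|t IHt] p k x Npt p1 nk xp dex.
  apply: top xp => [|pN]; first by lia.
  by have := nk 0%N; lia.
have [pN|Np] := ltP p N%:Z; last first.
  by apply: top xp => // pN; have := nk 0%N; lia.
have p2 : 2 <= p + 1 by lia.
have [x' x'p ex'] := exa p2 (gr_ez xp) dex.
have dex' : d (e x') = 0 by rewrite da_ez -ex' ez_ez oppr0.
have [||s sN|u [v [up vp x'E]]] := IHt _ _ _ _ _ _ x'p dex'; try lia.
  by have := nk s.+1; lia.
have vp' : gr (ihom (k - delta)) (p + 1) v.
  by move: vp; rewrite addrK (_ : k + 1 - delta - 1 = k - delta) //; lia.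
have [w wp wE] : exists2 w, gr (ihom (k - 1)) (p - 1) w & x + d v = e w.
  apply: ekz_exact => [||]; first by lia.
    apply: (subspaceD (subspace_gr _ _ (@subspace_ihomog _ _ _))) => //.
    by have := gr_da vp'; rewrite subrK addrK.
  by rewrite eD ex' x'E dD da_da add0r da_ez addNr.
exists (- v), w; split=> //.
  by apply: (subspaceN (subspace_gr _ _ (@subspace_ihomog _ _ _))).
by rewrite -wE linearN addrC addrK.
Qed.
End MainChase.

(** * Hilbert's Nullstellensatz over an uncountable field *)

(** Stated as what is used: no countable family of finite subsets covers C. *)
Definition uncountable (C : eqType) := forall s : nat -> seq C, exists t, forall k, t \notin s k.

Section Reals.
Variable R : realType.

(** Nested intervals, the k-th one avoiding f k. *)
Lemma real_nseq_neq (f : nat -> R) : exists t, forall k, f k != t.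
Proof.
pose step k (I : R * R) := let mid := (I.1 + I.2) / 2 in
  if f k < mid then (mid, I.2) else (I.1, (I.1 + mid) / 2).
pose I := fix I k := if k is k'.+1 then step k' (I k') else (0, 1).
have lt_I k : (I k).1 < (I k).2.
  by elim: k => [|k IHk] /=; [exact: ltr01 | rewrite /step; case: ifP => _ /=; lra].
have stepI k : ((I k).1 <= (I k.+1).1) && ((I k.+1).2 <= (I k).2).
  by have := lt_I k; rewrite /= /step; case: ifP => _ /=; lra.
have I1_mono j k : (j <= k)%N -> (I j).1 <= (I k).1.
  elim: k => [|k IHk]; first by rewrite leqn0 => /eqP->.
  rewrite leq_eqVlt => /orP[/eqP-> //|/IHk jk].
  by apply: le_trans jk _; have /andP[] := stepI k.
have I2_mono j k : (j <= k)%N -> (I k).2 <= (I j).2.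
  elim: k => [|k IHk]; first by rewrite leqn0 => /eqP->.
  rewrite leq_eqVlt => /orP[/eqP-> //|/IHk jk].
  by apply: le_trans jk; have /andP[] := stepI k.
have lt_I12 j k : (I j).1 < (I k).2.
  have [jk|/ltnW kj] := leqP j k.
    by apply: le_lt_trans (I1_mono _ _ jk) (lt_I k).
  by apply: lt_le_trans (lt_I j) (I2_mono _ _ kj).
pose E : R -> Prop := fun x => exists k, x = (I k).1.
have ubE k : classical_sets.ubound E (I k).2.
  by move=> _ [j ->]; apply/ltW.
have le1 k : (I k).1 <= sup E.
  by apply: ub_le_sup; [exists (I 0%N).2; exact: ubE | exists k].
have le2 k : sup E <= (I k).2.
  by apply: ge_sup; [exists (I 0%N).1; exists 0%N | exact: ubE].
exists (sup E) => k; have := le1 k.+1; have := le2 k.+1; have := lt_I k.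
rewrite /= /step; case: (ltP (f k) _) => /= fk lt12 h1 h2.
  by rewrite lt_eqF //; lra.
by rewrite gt_eqF //; lra.
Qed.

Lemma uncountable_complex : uncountable R[i].
Proof.
move=> s.
pose f k : R := if unpickle k is Some (i, j) then complex.Re (nth 0 (s i) j) else 0.
have [t ft] := real_nseq_neq f; exists (t%:C)%C => i.
apply/negP => ti; have := ft (pickle (i, index (t%:C)%C (s i))).
by rewrite /f pickleK nth_index //= eqxx.
Qed.
End Reals.

Section Nullstellensatz.
Variables (C : numClosedFieldType) (n : nat).
Hypothesis uncC : uncountable C.
Local Notation S := {mpoly C[n]}.

(** Otherwise all level sets of D would be finite, and there are countably many
    of them. *)
Lemma uncountable_fibre (D : C -> nat) (b : nat -> nat) :
  exists k s, [/\ uniq s, (b k < size s)%N & {in s, forall c, D c = k}].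
Proof.
apply: boolp.contrapT => H.
have small k s : uniq s -> {in s, forall c, D c = k} -> (size s <= b k)%N.
  by move=> us Ds; rewrite leqNgt; apply/negP => bs; apply: H; exists k, s.
have maxs k : exists s : seq C, forall c, D c = k -> c \in s.
  apply: boolp.contrapT => nos.
  have [s [us Ds bs]] : exists s, [/\ uniq s, {in s, forall c, D c = k} & size s = (b k).+1].
    elim: ((b k).+1) => [|m [s [us Ds sm]]]; first by exists [::].
    have [c [Dc cs]] : exists c, D c = k /\ c \notin s.
      apply: boolp.contrapT => noc; apply: nos; exists s => c Dc.
      by apply: contraT => cs; case: noc; exists c.
    exists (c :: s); rewrite /= cs us sm; split=> // x; rewrite inE.
    by case/orP => [/eqP->|/Ds].
  by have := small k s us Ds; rewrite bs ltnn.
have [s sP] := boolp.choice maxs.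
by have [t /(_ (D t))/negP[]] := uncC s; exact: sP.
Qed.

(** There are more polynomials than monomials of degree less than B. *)
Lemma mpoly_lindep K B (g : 'I_K -> S) : (forall j, (msize (g j) <= B)%N) ->
  (#|{: 'X_{1..n < B}}| < K)%N ->
  exists2 lam : 'I_K -> C, exists j, lam j != 0 & \sum_j lam j *: g j = 0.
Proof.
move=> gB ltK.
pose A : 'M[C]_(K, _) := \matrix_(j < K, m < #|{: 'X_{1..n < B}}|)
  (g j)@_(enum_val m : 'X_{1..n < B}).
have : kermx A != 0.
  rewrite -mxrank_eq0 mxrank_ker subn_eq0 -ltnNge.
  by apply: leq_ltn_trans (rank_leq_col A) ltK.
case/rowV0Pn => u /sub_kermxP uA u0; exists (u 0).
  apply/existsP; rewrite -negb_forall; apply: contra u0 => /forallP u0.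
  by apply/eqP/rowP => j; rewrite mxE; apply/eqP.
apply/mpolyP => m; rewrite mcoeff0 raddf_sum /=.
have [mB|Bm] := ltnP (mdeg m) B; last first.
  rewrite big1 // => j _; rewrite mcoeffZ memN_msupp_eq0 ?mulr0 //.
  by apply: msize_mdeg_ge; apply: leq_trans (gB j) Bm.
have := congr1 (fun M : 'rV_ _ => M 0 (enum_rank (BMultinom mB))) uA.
rewrite !mxE => uA0; rewrite -[RHS]uA0; apply: eq_bigr => j _.
by rewrite mcoeffZ !mxE enum_rankK.
Qed.

Definition is_ideal (J : S -> Prop) :=
  [/\ J 0, forall p q, J p -> J q -> J (p + q) & forall p q, J q -> J (p * q)].

Lemma ideal_sum J (I : Type) (r : seq I) (F : I -> S) : is_ideal J ->
  (forall i, J (F i)) -> J (\sum_(i <- r) F i).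
Proof. by case=> J0 JD _ JF; elim/big_ind: _. Qed.

(** Suppose that z_i - c is invertible modulo J for all c, with inverse g_c.
    Some level set of c |-> msize g_c contains more points than there are
    monomials of that degree; this gives a linear relation between finitely many
    g_c, and, after multiplication by the z_i - c, a nonzero polynomial q in z_i
    alone that belongs to J.  But q is a product of factors z_i - r, which are
    all invertible modulo J, so 1 belongs to J. *)
Lemma ideal_extend J i : is_ideal J -> ~ J 1 ->
  exists c, ~ exists g, J (1 - g * ('X_i - c%:MP)).
Proof.
move=> iJ J1; have [J0 JD JM] := iJ; apply: boolp.contrapT => H.
have {H} : forall c, exists g, J (1 - g * ('X_i - c%:MP)).
  by move=> c; apply: boolp.contrapT => Hc; apply: H; exists c.
move=> /boolp.choice[g gP].
have [B [s [us bs sB]]] := uncountable_fibre (fun c => msize (g c))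
  (fun B => #|{: 'X_{1..n < B}}|).
pose c (j : 'I_(size s)) := tnth (in_tuple s) j.
have c_inj : injective c.
  by move=> i1 i2 /eqP; rewrite /c !(tnth_nth 0) nth_uniq // => /eqP/val_inj.
have [|lam [j0 lam0] lamg] := @mpoly_lindep (size s) B (g \o c) _ bs.
  by move=> j; rewrite /= sB //; apply: mem_tnth.
(* [phi q] is q evaluated at the variable z_i. *)
pose phi (q : {poly C}) : S := (map_poly (@mpolyC n C) q).['X_i].
pose q : {poly C} := \sum_j lam j *: \prod_(k | k != j) ('X - (c k)%:P).
have phiXc r : phi ('X - r%:P) = 'X_i - r%:MP.
  by rewrite /phi rmorphB /= map_polyX map_polyC !hornerE.
have phiM p1 p2 : phi (p1 * p2) = phi p1 * phi p2.
  by rewrite /phi rmorphM hornerM.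
have phi1 : phi 1 = 1 by rewrite /phi rmorph1 hornerC.
have phi_prod (I : Type) (r : seq I) P (F : I -> {poly C}) :
    phi (\prod_(l <- r | P l) F l) = \prod_(l <- r | P l) phi (F l).
  by apply: big_morph.
have phiZ a p : phi (a *: p) = a *: phi p.
  by rewrite /phi -mul_polyC rmorphM hornerM /= map_polyC hornerC mul_mpolyC.
have q_neq0 : q != 0.
  apply/eqP => /(congr1 (horner^~ (c j0))); rewrite horner0 /q horner_sum.
  rewrite (bigD1 j0) //= [X in _ + X]big1 => [|j jj0]; last first.
    by rewrite hornerZ horner_prod (bigD1 j0) 1?eq_sym //= hornerXsubC subrr mul0r mulr0.
  rewrite addr0 hornerZ horner_prod => /eqP; rewrite mulf_eq0 (negPf lam0) /=.
  apply/negP; apply/prodf_neq0 => k kj; rewrite hornerXsubC subr_eq0.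
  by rewrite (inj_eq c_inj) eq_sym.
pose u k := 'X_i - (c k)%:MP.
have Jq : J (phi q).
  have -> : phi q = \sum_j lam j *: \prod_(k | k != j) u k.
    rewrite /q /phi rmorph_sum /= horner_sum; apply: eq_bigr => j _.
    rewrite -[LHS]/(phi _) phiZ phi_prod; congr (_ *: _).
    by apply: eq_bigr => k _; rewrite phiXc.
  have -> : \sum_j lam j *: \prod_(k | k != j) u k =
      \sum_j (lam j *: \prod_(k | k != j) u k) * (1 - g (c j) * u j)
      + (\prod_k u k) * \sum_j lam j *: g (c j).
    rewrite mulr_sumr -big_split /=; apply: eq_bigr => j _.
    rewrite [\prod_k u k](bigD1 j) //= -!scalerAr -!scalerAl -scalerDr.
    by congr (_ *: _); ring.
  rewrite lamg mulr0 addr0; apply: ideal_sum => // j; apply: JM; exact: gP.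
have [rs qE] := closed_field_poly_normal q.
(* The factors z_i - r can be cancelled modulo J. *)
have Jcancel : forall rs h, J (h * \prod_(r <- rs) ('X_i - r%:MP)) -> J h.
  elim=> [|r rs' IHrs] h; first by rewrite big_nil mulr1.
  rewrite big_cons mulrA => /IHrs Jh.
  have -> : h = h * (1 - g r * ('X_i - r%:MP)) + g r * (h * ('X_i - r%:MP)) by ring.
  by apply: JD; apply: JM.
apply: J1; apply: (Jcancel rs); rewrite mul1r.
have lc0 : lead_coef q != 0 by rewrite lead_coef_eq0.
have := JM (lead_coef q)^-1%:MP _ Jq; rewrite {2}qE phiZ phi_prod.
rewrite -mul_mpolyC mulrA -rmorphM /= mulVf // mul1r.
by under eq_bigr do rewrite phiXc.
Qed.

(** Specializing the variables one by one keeps the ideal proper. *)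
Lemma weak_nullstellensatz J : is_ideal J -> ~ J 1 ->
  exists x, forall p, J p -> p.@[x] = 0.
Proof.
move=> iJ J1.
have H (s : seq 'I_n) : exists J', [/\ is_ideal J', ~ J' 1, forall p, J p -> J' p &
    forall i, i \in s -> exists c, J' ('X_i - c%:MP)].
  elim: s => [|i s [J' [iJ' J'1 sJ Xs]]]; first by exists J; split.
  have [c cP] := ideal_extend i iJ' J'1; have [J0 JD JM] := iJ'.
  exists (fun p => exists g, J' (p - g * ('X_i - c%:MP))); split.
  - split.
    + by exists 0; rewrite mul0r subr0.
    + move=> p q [g1 h1] [g2 h2]; exists (g1 + g2).
      by rewrite mulrDl opprD addrACA; apply: JD.
    + by move=> p q [g h]; exists (p * g); rewrite -mulrA -mulrBr; apply: JM.
  - exact: cP.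
  - by move=> p /sJ Jp; exists 0; rewrite mul0r subr0.
  - move=> l; rewrite inE => /orP[/eqP->|/Xs[b hb]].
      by exists c, 1; rewrite mul1r subrr.
    by exists b, 0; rewrite mul0r subr0.
have [J' [[J0 JD JM] J'1 sJ Xs]] := H (enum 'I_n).
have /boolp.choice[x xP] : forall i, exists c, J' ('X_i - c%:MP).
  by move=> i; apply: Xs; rewrite mem_enum.
exists x => p Jp; apply/eqP; apply: contraT => px; case: J'1.
have Jx q : J' (q - (q.@[x])%:MP).
  have JXn i d : J' ('X_i ^+ d - (x i ^+ d)%:MP).
    elim: d => [|d IHd]; first by rewrite !expr0 subrr.
    have -> : 'X_i ^+ d.+1 - (x i ^+ d.+1)%:MP =
       'X_i ^+ d * ('X_i - (x i)%:MP) + (x i)%:MP * ('X_i ^+ d - (x i ^+ d)%:MP).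
      by rewrite !exprS mpolyCM; ring.
    by apply: JD; apply: JM.
  have JXm (m : 'X_{1..n}) r : J' (\prod_(i <- r) 'X_i ^+ m i - (\prod_(i <- r) x i ^+ m i)%:MP).
    elim: r => [|i r IHr]; first by rewrite !big_nil subrr.
    rewrite !big_cons mpolyCM.
    set A := 'X_i ^+ _; set B := \prod_(j <- r) _; set a := (x i ^+ _)%:MP; set b := _%:MP.
    have -> : A * B - a * b = B * (A - a) + a * (B - b) by ring.
    by apply: JD; apply: JM; [exact: JXn|exact: IHr].
  elim/mpolyind: q => [|c m q _ _ IHq]; first by rewrite meval0 subrr.
  rewrite mevalD mevalZ mevalX mpolyCD mpolyCM opprD addrACA; apply: JD => //.
  by rewrite -mul_mpolyC -mulrBr mpolyXE_id; apply: JM.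
have Jpx : J' (p.@[x])%:MP.
  have -> : (p.@[x])%:MP = p + -1 * (p - (p.@[x])%:MP) by ring.
  by apply: JD; [exact: sJ|apply: JM].
have := JM (p.@[x])^-1%:MP _ Jpx.
by rewrite -mpolyCM mulVf.
Qed.
End Nullstellensatz.

(** * Isolated zeros and the exactness of the Koszul complex *)

Section Powers.
Variables (C : numClosedFieldType) (n : nat).
Hypothesis uncC : uncountable C.
Local Notation S := {mpoly C[n]}.
Local Notation ihom := (@ihomog C n).

Lemma prj_ge_msize (g : S) t : (msize g <= t)%N -> prj t g = 0.
Proof.
move=> gt /=; rewrite pihomogE big_seq_cond big_pred0 // => m.
by apply/negP => /andP[/msize_mdeg_lt mg /eqP mt]; rewrite mt ltnNge gt in mg.
Qed.

(** By the weak Nullstellensatz 1 = h + g (z_i - 1) with h in the ideal J0 of the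
    y_l.  As J0 is homogeneous it contains the homogeneous parts of h, and
    weighting them with powers of z_i the sum telescopes to z_i^T + g_T, where
    g_T = 0 for large T. *)
Lemma powers_of_no_zero r (y : nat -> S) delta :
  (forall l, (l < r)%N -> ihom delta (y l)) ->
  (forall x, (forall l, (l < r)%N -> (y l).@[x] = 0) -> forall i, x i = 0) ->
  forall i, exists mu (c : nat -> S), 'X_i ^+ mu = \sum_(l < r) c l * y l.
Proof.
move=> hy noz i.
pose J0 (p : S) := exists c : nat -> S, p = \sum_(l < r) c l * y l.
have J00 : J0 0 by exists (fun=> 0); rewrite big1 // => l _; rewrite mul0r.
have J0D p q : J0 p -> J0 q -> J0 (p + q).
  move=> [c ->] [c' ->]; exists (fun l => c l + c' l).
  by rewrite -big_split; apply: eq_bigr => l _; rewrite mulrDl.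
have J0M p q : J0 q -> J0 (p * q).
  move=> [c ->]; exists (fun l => p * c l).
  by rewrite mulr_sumr; apply: eq_bigr => l _; rewrite mulrA.
have J0y l : (l < r)%N -> J0 (y l).
  move=> lr; exists (fun l' => (l' == l)%:R).
  rewrite (bigD1 (Ordinal lr)) //= eqxx mul1r big1 ?addr0 // => l' nl.
  by rewrite -[l' == l :> nat]/(l' == Ordinal lr) (negPf nl) mul0r.
pose J (p : S) := exists g, J0 (p - g * ('X_i - 1%:MP)).
have iJ : is_ideal J.
  split.
  - by exists 0; rewrite mul0r subr0.
  - move=> p q [g1 h1] [g2 h2]; exists (g1 + g2).
    by rewrite mulrDl opprD addrACA; apply: J0D.
  - by move=> p q [g h]; exists (p * g); rewrite -mulrA -mulrBr; apply: J0M.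
have [g [c hE]] : J 1.
  apply: boolp.contrapT => J1; have [x xJ] := weak_nullstellensatz uncC iJ J1.
  have xi0 : x i = 0.
    by apply: noz => l lr; apply: xJ; exists 0; rewrite mul0r subr0; exact: J0y.
  have : ('X_i - 1%:MP).@[x] = 0 by apply: xJ; exists 1; rewrite mul1r subrr.
  by rewrite mevalB mevalXU mevalC xi0 sub0r => /eqP; rewrite oppr_eq0 oner_eq0.
have J0prj t p : J0 p -> J0 (prj t p).
  move=> [b ->]; exists (fun l => prj (t - delta) (b l)).
  rewrite linear_sum; apply: eq_bigr => l _.
  by rewrite -[LHS]/(prj t _) mulrC (prjM _ _ (hy l (ltn_ord l))) mulrC.
pose h := 1 - g * ('X_i - 1%:MP).
have J0h : J0 h by exists c.
have hX : ihom 1 ('X_i : S) by exact: ihomogXU.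
have h_prj t : prj t h = prj t 1 - 'X_i * prj (t - 1) g + prj t g.
  rewrite -(prjM _ _ hX) -linearB -linearD; congr (prj t _).
  by rewrite /h mpolyC1; ring.
have prj1 t : prj t (1 : S) = (t == 0)%:R.
  have h1 : ihom 0 (1 : S) by exact: (@ihomogC _ _ 1).
  by case: eqVneq => [->|t0]; [rewrite prj_id|rewrite (prj_neq h1) // eq_sym].
have J0T (T : nat) : J0 ('X_i ^+ T + prj T g).
  elim: T => [|T IHT].
    by have := J0prj 0 _ J0h; rewrite h_prj prj1 eqxx /= mulr0 subr0 expr0.
  have -> : 'X_i ^+ T.+1 + prj T.+1 g = 'X_i * ('X_i ^+ T + prj T g) + prj T.+1 h.
    have T1 : T.+1%:Z - 1 = T by lia.
    by rewrite h_prj prj1 T1 exprS /=; ring.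
  by apply: J0D; [exact: J0M|exact: J0prj].
by have := J0T (msize g); rewrite prj_ge_msize // addr0 => -[c' E]; exists (msize g), c'.
Qed.
End Powers.

Section Isolated.
Variables (R : realType).
Local Notation C := R[i].

Definition isolated_set (I : Type) (Sg : (I -> C) -> Prop) :=
  forall x, Sg x -> exists2 e : C, 0 < e &
    forall y, Sg y -> (forall l, `|y l - x l| < e) -> y =1 x.

(** The square of side 1/K of the complex plane that contains z. *)
Definition cell (K : nat) (z : C) : int * int :=
  (Num.floor (K%:R * complex.Re z), Num.floor (K%:R * complex.Im z)).

Lemma floor_close (K : nat) (a b e : R) : (0 < K)%N -> K%:R^-1 < e ->
  Num.floor (K%:R * a) = Num.floor (K%:R * b) -> `|a - b| < e.
Proof.
move=> K0 Ke ab; apply: lt_trans Ke.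
have K0' : 0 < K%:R :> R by rewrite ltr0n.
have a1 := floor_itv (K%:R * a); have b1 := floor_itv (K%:R * b).
rewrite -div1r ltr_pdivlMr // -[X in _ * X]ger0_norm ?ltW // -normrM.
rewrite ab in a1.
rewrite ltr_norml; apply/andP.
rewrite mulrBl ![_ * K%:R]mulrC; move: a1 b1; rewrite intrD => /andP[? ?] /andP[? ?].
by split; lra.
Qed.

Lemma cell_close (e : C) : 0 < e -> exists K, forall z z' : C,
  cell K z = cell K z' -> `|z - z'| < e.
Proof.
case: e => e1 e2; rewrite ltcE /= => /andP[/eqP-> e0].
have [K Ke] : exists K : nat, K.+1%:R^-1 < e1 / 2.
  exists (Num.bound (e1 / 2)^-1).
  have h : 0 < e1 / 2 by lra.
  rewrite -[X in _ < X]invrK ltf_pV2 ?posrE ?invr_gt0 ?ltr0n //.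
  apply: lt_trans (archi_boundP _) _; first by rewrite invr_ge0 ltW.
  by rewrite ltr_nat.
exists K.+1 => z z' [/(floor_close _ Ke) hr /(floor_close _ Ke) hi].
rewrite normc_def ltcR -[e1]ger0_norm ?ltW // -sqrtr_sqr ltr_sqrt ?exprn_gt0 //.
rewrite !raddfB /=; have := hr isT; have := hi isT.
rewrite !ltr_norml => /andP[h1 h2] /andP[h3 h4].
have : (complex.Re z - complex.Re z') ^+ 2 < (e1 / 2) ^+ 2 by nra.
have : (complex.Im z - complex.Im z') ^+ 2 < (e1 / 2) ^+ 2 by nra.
by nra.
Qed.

(** The code consists of a scale K, depending on x, at which x is the only point
    of Sg in its cell, and of the name of that cell. *)
Lemma isolated_code (I : finType) (Sg : (I -> C) -> Prop) : isolated_set Sg ->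
  exists code : (I -> C) -> nat * {ffun I -> int * int},
    forall x y, Sg x -> Sg y -> code x = code y -> y =1 x.
Proof.
move=> iso.
have HK x : exists K, Sg x -> forall y, Sg y ->
    (forall l, cell K (y l) = cell K (x l)) -> y =1 x.
  have [Sx|nSx] := boolp.EM (Sg x); last by exists 0%N.
  have [e e0 eP] := iso x Sx; have [K KP] := cell_close e0.
  by exists K => _ y Sy xy; apply: eP => // l; apply: KP.
have [K KP] := boolp.choice HK.
exists (fun x => (K x, [ffun l => cell (K x) (x l)])) => x y Sx Sy [Kxy /ffunP xy].
by apply: KP => // l; have := xy l; rewrite !ffunE -Kxy => ->.
Qed.

Variable n : nat.
Local Notation N := n.+1.

(** On the moment curve (1, t, ..., t^n), each point excludes the roots t of one
    nonzero polynomial; there are countably many points. *)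
Lemma avoiding_hyperplane (Sg : 'I_N -> ('I_n -> C) -> Prop) :
  (forall i, isolated_set (Sg i)) ->
  exists t : C, forall i x, Sg i x -> \sum_(k < N) t ^+ k * hcoord i x k != 0.
Proof.
move=> iso; have := fun i => isolated_code (iso i).
move/fin_all_exists => [code codeP].
pose T := ('I_N * (nat * {ffun 'I_n -> int * int}))%type.
have HT (u : T) : exists rs : seq C, forall x, Sg u.1 x -> code u.1 x = u.2 ->
    forall t, \sum_(k < N) t ^+ k * hcoord u.1 x k = 0 -> t \in rs.
  case: u => i c /=.
  have [[x0 [Sx0 cx0]]|nox] := boolp.EM (exists x, Sg i x /\ code i x = c); last first.
    by exists [::] => x Sx cx; case: nox; exists x.
  pose q : {poly C} := \poly_(k < N) hcoord i x0 (inord k).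
  have q0 : q != 0.
    apply/eqP => /(congr1 (fun p : {poly C} => p`_i)); rewrite coef0 coef_poly ltn_ord.
    by rewrite inord_val /hcoord unlift_none => /eqP; rewrite oner_eq0.
  have [rs qE] := closed_field_poly_normal q.
  exists rs => x Sx cx t tx.
  have xx0 : x =1 x0 by apply: (codeP i) => //; rewrite cx.
  have : root q t.
    rewrite /root horner_poly -[X in _ == X]tx; apply/eqP/eq_bigr => k _.
    by rewrite inord_val mulrC /hcoord; case: unlift => // l; rewrite xx0.
  by rewrite qE rootZ ?lead_coef_eq0 // root_prod_XsubC.
have [rs rsP] := boolp.choice HT.
have [t tP] := uncountable_complex (fun k => if unpickle k is Some u then rs u else [::]).
exists t => i x Sx; apply/eqP => tx.
have := tP (pickle (i, code i x)); rewrite pickleK => /negP; apply.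
exact: (rsP (i, code i x) x Sx erefl t tx).
Qed.

(** The power l^delta is used, rather than l, so that all the elements have the
    same degree delta. *)
Lemma koszul_exact (a : nat -> {mpoly C[N]}) delta : 0 < delta ->
  (forall k, (k < N)%N -> ihomog delta (a k)) ->
  (forall i : 'I_N, isolated_set (fun x : 'I_n -> C =>
       forall k, (k < N)%N -> (a k).@[hcoord i x] = 0)) ->
  forall p, 2 <= p -> exact_at (@ihomog C N) (yop a) delta N p.
Proof.
move=> d0 ha iso p p2; have [t tP] := avoiding_hyperplane iso.
pose f : {mpoly C[N]} := \sum_(k < N) t ^+ k *: 'X_k.
have hf : ihomog 1 f.
  apply: big_ind => [|u v|k _]; first exact: (@subspace_ihomog C N 1).1.
    exact: (subspaceD (@subspace_ihomog _ _ _)).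
  by apply: (subspaceZ _ (@subspace_ihomog _ _ _)); exact: ihomogXU.
have [D dD] : exists D : nat, delta = D%:Z by exists (absz delta); lia.
pose y k := if (k < N)%N then a k else f ^+ D.
have hfD : ihomog delta (f ^+ D) by rewrite dD -[D%:Z]mul1r; exact: ihomogXn.
have hy k : (k < N.+1)%N -> ihomog delta (y k).
  by move=> _; rewrite /y; case: ifP => // kN; exact: ha.
have yN : y N = f ^+ D by rewrite /y ltnn.
apply: (@exact_of_cone _ _ a y) => // [|k kN|]; first by rewrite yN.
  by rewrite /y kN.
apply: exact_of_powers => //; last by lia.
apply: (powers_of_no_zero (@uncountable_complex R) hy) => z z0 i.
apply/eqP; apply: contraT => zi.
pose x l := z (lift i l) / z i.
have zE k : z k = z i * hcoord i x k.
  rewrite /hcoord; case: unliftP => [l ->|->]; last by rewrite mulr1.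
  by rewrite /x mulrC divfK.
have unscale k g : ihomog k g -> g.@[z] = 0 -> g.@[hcoord i x] = 0.
  move=> hp /eqP; rewrite (meval_eq _ zE) (meval_homog _ zi hp) mulf_eq0.
  by rewrite expfz_eq0 (negPf zi) andbF => /eqP.
have ax k : (k < N)%N -> (a k).@[hcoord i x] = 0.
  move=> kN; apply: unscale (ha k kN) _.
  by have := z0 k (ltnW kN); rewrite /y kN.
have /negP[] := tP i x ax.
apply/eqP; rewrite -[RHS](unscale _ _ hf).
  by rewrite /f raddf_sum /=; apply: eq_bigr => k _; rewrite mevalZ mevalXU.
by apply/eqP; have := z0 N (leqnn _); rewrite yN rmorphXn => /eqP; rewrite expf_eq0 => /andP[].
Qed.
End Isolated.

(** * From the charts of projective space to the cone *)

Section Glue.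
Variables (C : fieldType) (n : nat).
Local Notation N := n.+1.
Local Notation S := {mpoly C[N]}.
Local Notation ihom := (@ihomog C N).

Lemma mpolyXUn (i : 'I_N) T : 'X_i ^+ T = 'X_[C, U_(i) *+ T] :> S.
Proof. by rewrite mpolyXn. Qed.

(** Compare coefficients: on the left, the exponents of 'X_i are those of A. *)
Lemma divisible_by_power (i j : 'I_N) T (A B : S) : i != j ->
  'X_j ^+ T * A = 'X_i ^+ T * B -> exists a, A = 'X_i ^+ T * a.
Proof.
move=> ij; rewrite !mpolyXUn => AB.
have leT m : m \in msupp A -> (U_(i) *+ T <= m)%MM.
  rewrite mcoeff_msupp => Am.
  have : (U_(j) *+ T + m)%MM \in msupp (B * 'X_[U_(i) *+ T]).
    by rewrite mcoeff_msupp mulrC -AB mulrC mcoeffMX.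
  rewrite (perm_mem (msuppMX _ _)) => /mapP[m' _ /mnmP E].
  apply/mnm_lepP => l; rewrite mulmnE mnm1E; case: eqP => [<-|_]; last by rewrite mul0n.
  rewrite mul1n; have := E i; rewrite !mnmDE !mulmnE !mnm1E eqxx mul1n.
  by rewrite eq_sym (negPf ij) mul0n add0n => ->; rewrite leq_addr.
exists (\sum_(m <- msupp A) A@_m *: 'X_[m - U_(i) *+ T]).
rewrite {1}[A]mpolyE mulr_sumr; apply: eq_big_seq => m mA.
by rewrite -scalerAr -mpolyXD addmC submK ?leT.
Qed.

Lemma ihomog_divX k T i (a : S) : ihom k ('X_i ^+ T * a) -> ihom (k - T%:Z) a.
Proof.
move=> h m ma; have <- : (mdeg (U_(i) *+ T + m)%MM)%:Z = k.
  by apply: h; rewrite mcoeff_msupp mpolyXUn mulrC mcoeffMX -mcoeff_msupp.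
by rewrite mdegD mdegMn mdeg1 mul1n PoszD addrC addKr.
Qed.

Lemma mulX_inj (i : 'I_N) T : injective (fun a : S => 'X_i ^+ T * a).
Proof.
apply: mulfI; rewrite expf_neq0 // -msupp_eq0 msuppX //.
Qed.

(** A function that is regular on every chart {z_i != 0} of the cone is a
    polynomial: A i / 'X_i^T is its expression over the i-th chart. *)
Lemma glue_mpoly E T (A : 'I_N -> S) : (0 < n)%N -> (forall i, ihom E (A i)) ->
  (forall i j, 'X_j ^+ T * A i = 'X_i ^+ T * A j) ->
  exists2 a, ihom (E - T%:Z) a & forall i, A i = 'X_i ^+ T * a.
Proof.
move=> n0 hA AA; have n0' : ord0 != ord_max :> 'I_N by rewrite -val_eqE /= eq_sym -lt0n.
have [a aE] := divisible_by_power n0' (AA ord0 ord_max).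
exists a; first by apply: (@ihomog_divX _ _ ord0); rewrite -aE.
move=> i; apply: (@mulX_inj ord0 T); rewrite /= AA aE; ring.
Qed.

Lemma glue_kos E T M p (A : 'I_N -> kos S M) : (0 < n)%N ->
  (forall i, gr (ihom E) p (A i)) ->
  (forall i j, kmap (mulop ('X_j ^+ T)) (A i) = kmap (mulop ('X_i ^+ T)) (A j)) ->
  exists2 x, gr (ihom (E - T%:Z)) p x & forall i, A i = kmap (mulop ('X_i ^+ T)) x.
Proof.
move=> n0; elim: M p A => [|M IHM] p A /= hA AA.
  case: eqVneq hA => [_ hA|_ A0]; first exact: glue_mpoly.
  by exists 0 => // i; rewrite A0 linear0.
have [||x1 x1p x1E] := IHM p (fun i => (A i).1).
- by move=> i; case: (hA i).
- by move=> i j; case: (AA i j).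
have [||x2 x2p x2E] := IHM (p - 1) (fun i => (A i).2).
- by move=> i; case: (hA i).
- by move=> i j; case: (AA i j).
by exists (x1, x2) => // i; rewrite [LHS]surjective_pairing x1E x2E.
Qed.

Lemma kmap_inj0 (f : S -> S) M (x : kos S M) : (forall c, f c = 0 -> c = 0) ->
  kmap f x = 0 -> x = 0.
Proof.
move=> f0; elim: M x => [x /f0 //|M IHM [x1 x2] /= [e1 e2]].
by rewrite (IHM _ e1) (IHM _ e2).
Qed.
End Glue.

Section Homogenize.
Variables (C : fieldType) (n : nat).
Local Notation N := n.+1.
Local Notation S := {mpoly C[N]}.
Local Notation ihom := (@ihomog C N).
Implicit Types (q : {mpoly C[n]}) (z : 'I_N -> C).

(** z_i^D q(z / z_i), provided that D is at least the degree of q. *)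
Definition homogenize (i : 'I_N) D q : S :=
  \sum_(m <- msupp q) q@_m *: ('X_i ^+ (D - mdeg m) * \prod_l 'X_(lift i l) ^+ m l).

Definition chart_pt (i : 'I_N) z (l : 'I_n) := z (lift i l) / z i.

Lemma ihomog_homogenize i D q : (msize q <= D.+1)%N -> ihom D (homogenize i D q).
Proof.
move=> qD; rewrite /homogenize big_seq; apply: big_ind => [|u v|m mq].
- exact: (@subspace_ihomog C N D).1.
- exact: (subspaceD (@subspace_ihomog _ _ _)).
apply: (subspaceZ _ (@subspace_ihomog _ _ _)).
have hprod : ihom (mdeg m) (\prod_l 'X_(lift i l) ^+ m l).
  rewrite mdegE; elim/big_rec2: _ => [|l p d _ hp]; first exact: (@ihomogC C N 1).
  by rewrite PoszD; apply: ihomogM hp; rewrite -[(m l)%:Z]mul1r; apply/ihomogXn/ihomogXU.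
have mD : (mdeg m <= D)%N by rewrite -ltnS; apply: leq_trans (msize_mdeg_lt mq) qD.
rewrite -[in ihom _](subnK mD) PoszD; apply: ihomogM => //.
by rewrite -[(D - mdeg m)%N%:Z]mul1r; apply/ihomogXn/ihomogXU.
Qed.

Lemma meval_homogenize i D q z : (msize q <= D.+1)%N -> z i != 0 ->
  (homogenize i D q).@[z] = z i ^+ D * q.@[chart_pt i z].
Proof.
move=> qD zi; rewrite /homogenize raddf_sum mevalE mulr_sumr; apply: eq_big_seq => m mq /=.
have mD : (mdeg m <= D)%N by rewrite -ltnS; apply: leq_trans (msize_mdeg_lt mq) qD.
rewrite mevalZ mevalM rmorphXn rmorph_prod /= mevalXU [RHS]mulrCA; congr (_ * _).
rewrite -[in RHS](subnK mD) exprD -mulrA mdegE -prodrXr -big_split /=; congr (_ * _).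
apply: eq_bigr => l _.
by rewrite rmorphXn /= mevalXU -exprMn /chart_pt mulrC divfK.
Qed.

Lemma hcoord_chart_pt i z k : z i != 0 -> hcoord i (chart_pt i z) k = z k / z i.
Proof.
move=> zi; rewrite /hcoord; case: unliftP => [l ->|->]; first by [].
by rewrite divff.
Qed.

Lemma hcoord_self (i : 'I_N) (x : 'I_n -> C) : hcoord i x i = 1.
Proof. by rewrite /hcoord unlift_none. Qed.

Lemma hcoord_lift (i : 'I_N) (x : 'I_n -> C) l : hcoord i x (lift i l) = x l.
Proof. by rewrite /hcoord liftK. Qed.

Lemma hvec_self (i : 'I_N) (v : 'I_n -> C) : hvec i v i = 0.
Proof. by rewrite /hvec unlift_none. Qed.

Lemma hvec_lift (i : 'I_N) (v : 'I_n -> C) l : hvec i v (lift i l) = v l.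
Proof. by rewrite /hvec liftK. Qed.

Lemma chart_pt_hcoord (i : 'I_N) (x : 'I_n -> C) : chart_pt i (hcoord i x) =1 x.
Proof. by move=> l; rewrite /chart_pt hcoord_lift hcoord_self divr1. Qed.

Lemma trans_chart_pt i j z : z i != 0 -> z j != 0 -> trans i j (chart_pt i z) =1 chart_pt j z.
Proof. by move=> zi zj l; rewrite /trans !hcoord_chart_pt // /chart_pt; field; rewrite zi zj. Qed.
End Homogenize.

Section Global.
Variables (C : numFieldType) (n : nat).
Hypothesis n0 : (0 < n)%N.
Local Notation N := n.+1.
Local Notation S := {mpoly C[N]}.
Local Notation ihom := (@ihomog C N).
Local Notation Z := (@zop C n).
Implicit Types (X w : chart_family C n).

(** Multiplying by 'X_i 'X_j makes the identity hold at all points. *)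
Lemma mpoly_eq_overlap (i j : 'I_N) (p q : S) :
  (forall z, z i != 0 -> z j != 0 -> p.@[z] = q.@[z]) -> p = q.
Proof.
move=> pq; apply/eqP; rewrite -subr_eq0; apply/eqP.
have X0 l : ('X_l : S) != 0 by rewrite -msupp_eq0 msuppX.
suff /eqP : 'X_i * 'X_j * (p - q) = 0.
  by rewrite !mulf_eq0 (negPf (X0 i)) (negPf (X0 j)) => /eqP.
apply: mpoly_eq0_meval => z; rewrite !mevalM mevalB !mevalXU.
have [->|zi] := eqVneq (z i) 0; first by rewrite !mul0r.
have [->|zj] := eqVneq (z j) 0; first by rewrite mulr0 !mul0r.
by rewrite pq // subrr mulr0.
Qed.

Lemma ihomog_eq0_chart k (i : 'I_N) (p : S) : ihom k p ->
  (forall x, p.@[hcoord i x] = 0) -> p = 0.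
Proof.
move=> hp p0; apply: (@mpoly_eq_overlap i i) => z zi _; rewrite meval0.
have zE l : z l = z i * hcoord i (chart_pt i z) l by rewrite hcoord_chart_pt // mulrC divfK.
by rewrite (meval_eq _ zE) (meval_homog _ zi hp) p0 mulr0.
Qed.

Lemma family_bound X (k : int) : exists D : nat,
  (forall i l, (msize (X i l) <= D.+1)%N) /\ k <= D%:Z.
Proof.
exists (\sum_i \sum_l msize (X i l) + absz k)%N; split=> [i l|]; last by lia.
rewrite (bigD1 i) //= (bigD1 l) //=; lia.
Qed.

(** The differential at z of the projection z |-> z / z_i of the cone to the
    i-th chart, applied to e. *)
Definition chart_dpt (i : 'I_N) (z e : 'I_N -> C) (l : 'I_n) : C :=
  (e (lift i l) * z i - z (lift i l) * e i) / z i ^+ 2.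

Lemma hvec_chart_dpt i z e k : z i != 0 ->
  hvec i (chart_dpt i z e) k = (e k * z i - z k * e i) / z i ^+ 2.
Proof.
move=> zi; rewrite /hvec; case: unliftP => [l ->|->]; first by [].
by rewrite [e i * _]mulrC subrr mul0r.
Qed.

Lemma dtrans_chart_dpt i j z e : z i != 0 -> z j != 0 ->
  dtrans i j (chart_pt i z) (chart_dpt i z e) =1 chart_dpt j z e.
Proof.
move=> zi zj l; rewrite /dtrans !hvec_chart_dpt // !hcoord_chart_pt // /chart_dpt; field.
by rewrite zi zj.
Qed.

Lemma eq_fform w i x x' v v' : x =1 x' -> v =1 v' -> fform w i x v = fform w i x' v'.
Proof.
by move=> xx' vv'; apply: eq_bigr => l _; rewrite (meval_eq _ xx') vv'.
Qed.

(** The pull-back of the form to the cone does not depend on the chart. *)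
Lemma twisted_form_cone k w i j z e : twisted_form k w -> z i != 0 -> z j != 0 ->
  z i ^ k * fform w i (chart_pt i z) (chart_dpt i z e) =
    z j ^ k * fform w j (chart_pt j z) (chart_dpt j z e).
Proof.
move=> tw zi zj; have hj : hcoord i (chart_pt i z) j != 0.
  by rewrite hcoord_chart_pt // mulf_neq0 // invr_neq0.
have := tw i j (chart_pt i z) hj (chart_dpt i z e).
rewrite (@eq_fform w j _ (chart_pt j z) _ (chart_dpt j z e)); last 2 first.
- exact: trans_chart_pt.
- exact: dtrans_chart_dpt.
move=> ->; rewrite hcoord_chart_pt // mulrA; congr (_ * _).
by rewrite expfzMl exprz_inv opprK mulrA -expfzDr // subrr expr0z mul1r.
Qed.

(** The coefficient of dz_j in the pull-back of the form to the cone is computed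
    in each chart by the chain rule and glued. *)
Lemma form_of_family k w : twisted_form k w ->
  exists a : 'I_N -> S, [/\ forall j, ihom (k - 1) (a j), \sum_j a j * 'X_j = 0 &
    forall i l x, (w i l).@[x] = (a (lift i l)).@[hcoord i x]].
Proof.
move=> tw; have [D [wD kD]] := family_bound w k.
pose A j i : S := \sum_l homogenize i D (w i l) *
  ((lift i l == j)%:R * 'X_i - (i == j)%:R * 'X_(lift i l)).
have hA j i : ihom (D.+1) (A j i).
  rewrite /A; apply: big_ind => [|u v|l _].
  - exact: (@subspace_ihomog C N _).1.
  - exact: (subspaceD (@subspace_ihomog _ _ _)).
  rewrite -[D.+1]addn1 PoszD; apply: ihomogM; first exact: ihomog_homogenize.
  have hX (b : bool) l' : ihom 1 (b%:R * 'X_l').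
    case: b; rewrite ?mul1r ?mul0r; first exact: ihomogXU.
    exact: (@subspace_ihomog C N _).1.
  by apply: (subspaceB (@subspace_ihomog _ _ _)).
have evA j i z : z i != 0 -> (A j i).@[z] = z i ^+ D.+2 *
    fform w i (chart_pt i z) (chart_dpt i z (fun l => (l == j)%:R)).
  move=> zi; rewrite /A raddf_sum /fform mulr_sumr; apply: eq_bigr => l _ /=.
  rewrite mevalM meval_homogenize // mevalB !mevalM !mevalXU /chart_dpt.
  have mevalb (b : bool) : (b%:R : S).@[z] = b%:R by case: b; rewrite ?meval1 ?meval0.
  by rewrite !mevalb !exprS; field.
have [T TE] : exists T : nat, T%:Z = D.+2%:Z - k by exists (absz (D.+2%:Z - k)%R); lia.
have glueA j i i' : 'X_i' ^+ T * A j i = 'X_i ^+ T * A j i'.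
  apply: (@mpoly_eq_overlap i i') => z zi zi'.
  rewrite !mevalM !rmorphXn /= !mevalXU !evA //.
  have zT l : z l != 0 -> z l ^+ D.+2 = z l ^+ T * z l ^ k.
    by move=> zl; rewrite [_ ^+ D.+2]exprnP [_ ^+ T]exprnP -expfzDr // TE subrK.
  rewrite (zT i) // (zT i') // -!mulrA (twisted_form_cone _ tw zi zi').
  by rewrite mulrCA.
have glue j := @glue_mpoly C n D.+1 T (A j) n0 (hA j) (glueA j).
have [a ha aE] := fin_all_exists2 glue.
have kE : D.+1%:Z - T%:Z = k - 1 by lia.
exists a; split=> [j||i l x].
- by rewrite -kE.
- apply: (@mulX_inj C n ord0 T); rewrite /= mulr0 mulr_sumr.
  under eq_bigr do rewrite mulrA -aE /A mulr_suml.
  rewrite exchange_big big1 // => l _ /=.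
  under eq_bigr do rewrite -mulrA.
  rewrite -mulr_sumr; apply/eqP; rewrite mulf_eq0; apply/orP; right; apply/eqP.
  under eq_bigr do rewrite mulrBl -!mulrA ![_%:R * _]mulrC.
  have sum1 (c : S) (i0 : 'I_N) : \sum_i c * 'X_i * (i0 == i)%:R = c * 'X_i0.
    rewrite (bigD1 i0) //= eqxx mulr1 big1 ?addr0 // => i ii0.
    by rewrite eq_sym (negPf ii0) mulr0.
  by rewrite sumrB !sum1 mulrC subrr.
have xi : hcoord i x i != 0 by rewrite hcoord_self oner_neq0.
have := congr1 (meval (hcoord i x)) (aE (lift i l) i).
rewrite mevalM rmorphXn /= mevalXU hcoord_self expr1n mul1r => <-.
rewrite evA // hcoord_self expr1n mul1r /fform.
rewrite (bigD1 l) //= big1 => [|l' l'l].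
  rewrite (meval_eq _ (@chart_pt_hcoord _ _ i x)) /chart_dpt hcoord_self eqxx.
  by rewrite (negPf (neq_lift i l)) mulr0 subr0 expr1n divr1 !mulr1 addr0.
rewrite /chart_dpt hcoord_self (inj_eq lift_inj) (negPf l'l).
by rewrite (negPf (neq_lift i l)) mulr0 mul0r subr0 mul0r mulr0.
Qed.

Definition dehom (i : 'I_N) (p : S) : {mpoly C[n]} :=
  p \mPo [tuple (if unlift i k is Some l then 'X_l else 1) | k < N].

Lemma meval_dehom i p x : (dehom i p).@[x] = p.@[hcoord i x].
Proof.
rewrite /dehom comp_mpoly_meval; apply: meval_eq => k.
by rewrite tnth_mktuple /hcoord; case: unlift => [l|]; rewrite ?mevalXU ?meval1.
Qed.

(** The projection of the field with components Y_k on the cone: subtracting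
    Y_i times the Euler field makes it tangent to {z_i = 1}. *)
Definition vfield_of (y : kos S N) : chart_family C n :=
  [ffun i : 'I_N => [ffun l => dehom i (kcoord (lift i l) y) - 'X_l * dehom i (kcoord i y)]].

Fact vfield_of_is_linear : linear vfield_of.
Proof.
move=> c y y'; apply/ffunP => i; apply/ffunP => l; rewrite !ffunE /dehom !linearP /=.
by rewrite -!mul_mpolyC; ring.
Qed.
HB.instance Definition _ := GRing.isLinear.Build C (kos S N) (chart_family C n) *:%R
  vfield_of vfield_of_is_linear.

Lemma meval_vfield_of y i l x : (vfield_of y i l).@[x] =
  (kcoord (lift i l) y).@[hcoord i x] - x l * (kcoord i y).@[hcoord i x].
Proof. by rewrite !ffunE mevalB mevalM mevalXU !meval_dehom. Qed.

Lemma hvec_vfield_of y i x (k : 'I_N) : hvec i (fvec (vfield_of y) i x) k =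
  (kcoord k y).@[hcoord i x] - hcoord i x k * (kcoord i y).@[hcoord i x].
Proof.
rewrite /hvec; case: unliftP => [l ->|->]; last by rewrite hcoord_self mul1r subrr.
by rewrite /fvec meval_vfield_of hcoord_lift.
Qed.

Lemma hcoord_trans (i j : 'I_N) (x : 'I_n -> C) k : hcoord i x j != 0 ->
  hcoord j (trans i j x) k = (hcoord i x j)^-1 * hcoord i x k.
Proof.
move=> xj; rewrite {1}/hcoord; case: unliftP => [l ->|->]; last by rewrite mulVf.
by rewrite /trans mulrC.
Qed.

Lemma vfield_of_twisted k y : gr (ihom k) 1 y -> twisted_vfield (k - 1) (vfield_of y).
Proof.
move=> yk i j x xj l; have [hy _] := gr1_kvec yk.
have evy (b : 'I_N) : (kcoord b y).@[hcoord j (trans i j x)] =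
    (hcoord i x j) ^ (- k) * (kcoord b y).@[hcoord i x].
  rewrite (meval_eq _ (fun b' => hcoord_trans b' xj)).
  by rewrite (meval_homog _ _ (hy _ (ltn_ord b))) ?invr_neq0 // exprz_inv.
rewrite /fvec meval_vfield_of !evy /dtrans !hvec_vfield_of /trans opprB.
set u := (kcoord _ y).@[_]; set v := (kcoord _ y).@[_]; set t := (kcoord i y).@[_].
set h := hcoord i x j in xj *; set c := hcoord i x (lift j l).
rewrite addrC expfzDr // expr1z; field; exact: xj.
Qed.

Lemma zopE (k : 'I_N) c : Z k c = 'X_k * c.
Proof. by rewrite /zop /= inord_val. Qed.

Lemma vfield_of_ek k (v : kos S N) : gr (ihom k) 0 v -> vfield_of (ek Z v) = 0.
Proof.
move=> /gr0_kconst[_ ->]; rewrite ek_kconst.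
apply/ffunP => i; apply/ffunP => l; apply/eqP; rewrite -subr_eq0; apply/eqP.
apply: mpoly_eq0_meval => x; rewrite mevalB meval_vfield_of !ffunE meval0 subr0.
rewrite !kcoord_kvec // !zopE !mevalM !mevalXU.
by rewrite hcoord_self hcoord_lift mul1r subrr.
Qed.

Lemma kmap_kvec (f : {linear S -> S}) M (v : nat -> S) :
  kmap f (kvec M v) = kvec M (f \o v).
Proof. by elim: M => [|M IHM] /=; rewrite ?linear0 // IHM kmap_kconst. Qed.

Lemma kvecB M (v v' : nat -> S) : kvec M v - kvec M v' = kvec M (fun k => v k - v' k).
Proof.
elim: M => [|M IHM] /=; first by rewrite subrr.
by rewrite -IHM linearB.
Qed.

Lemma kcoord_kmap (f : {linear S -> S}) M k (u : kos S M) :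
  kcoord k (kmap f u) = f (kcoord k u).
Proof.
elim: M u => [|M IHM] u /=; first by rewrite linear0.
by case: ifP => _; rewrite ?kcst_kmap.
Qed.

Lemma eq_kvec_ek k (y : kos S N) : gr (ihom k) 1 y -> ek Z y = 0 ->
  exists2 v, gr (ihom (k - 1)) 0 v & y = ek Z v.
Proof. by move=> yk ey; apply: (ekz_exact _ yk ey) => -[_]; lia. Qed.

Lemma vfield_of_eq0 k (y : kos S N) : gr (ihom k) 1 y -> vfield_of y = 0 ->
  exists2 v, gr (ihom (k - 1)) 0 v & y = ek Z v.
Proof.
move=> yk y0; apply: (eq_kvec_ek yk); have [hy yE] := gr1_kvec yk.
have Xy (b : 'I_N) : 'X_ord0 * kcoord b y = 'X_b * kcoord (@ord0 n) y.
  apply/eqP; rewrite -subr_eq0; apply/eqP.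
  apply: (@ihomog_eq0_chart (1 + k) ord0) => [|x].
    by apply: (subspaceB (@subspace_ihomog _ _ _)); apply: ihomogM (hy _ _);
      rewrite ?ltn_ord //; exact: ihomogXU.
  rewrite mevalB !mevalM !mevalXU hcoord_self mul1r -hvec_vfield_of y0.
  by rewrite /hvec; case: unlift => // l; rewrite /fvec !ffunE meval0.
apply: (@kmap_inj0 C n (mulop 'X_ord0)) => [c /eqP|].
  by rewrite /mulop mulf_eq0 -[_ == 0 :> S]msupp_eq0 msuppX => /eqP.
rewrite (@kmap_ek _ _ _ _ _ Z) => [|i _ c]; last exact: mulopC.
have -> : kmap (mulop 'X_ord0) y = ek Z (kconst N (kcoord (@ord0 n) y)).
  rewrite ek_kconst {1}yE kmap_kvec; apply: eq_kvec => i iN.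
  by have := Xy (Ordinal iN); rewrite -[in X in _ = X -> _]zopE.
by rewrite ekek // => i j _ _ c; exact: mulopC.
Qed.

(** Lifting a vector field to the cone is possible in each chart, but the lifts
    differ by multiples of the Euler field z.  The bivectors that are their wedge
    products with z agree, hence glue to a bivector x with e x = 0; by exactness
    x = e y, and y is the lift. *)
Lemma family_of_vfield d X : (1 < n)%N -> twisted_vfield (d - 1) X ->
  exists2 y, gr (ihom d) 1 y & X = vfield_of y.
Proof.
move=> n1 tX; have [D [XD dD]] := family_bound X d.
pose Y i (k : 'I_N) : S := if unlift i k is Some l then homogenize i D (X i l) else 0.
have hY i k : ihom D (Y i k).
  rewrite /Y; case: unlift => [l|]; first exact: ihomog_homogenize.
  exact: (@subspace_ihomog C N _).1.
have evY i k z : z i != 0 -> (Y i k).@[z] = z i ^+ D * hvec i (fvec X i (chart_pt i z)) k.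
  move=> zi; rewrite /Y /hvec; case: unlift => [l|]; last by rewrite meval0 mulr0.
  exact: meval_homogenize.
have [T TE] : exists T : nat, T%:Z = D%:Z - d by exists (absz (D%:Z - d)%R); lia.
(* Y_j = Y_i - (Y_i)_j / z_j z for the lifts on the cone. *)
have cone i j z k : z i != 0 -> z j != 0 ->
    z j * (z j ^ d * hvec j (fvec X j (chart_pt j z)) k) =
    z i ^ d * (z j * hvec i (fvec X i (chart_pt i z)) k - z k * hvec i (fvec X i (chart_pt i z)) j).
  move=> zi zj; have hj : hcoord i (chart_pt i z) j != 0.
    by rewrite hcoord_chart_pt // mulf_neq0 // invr_neq0.
  case: (unliftP j k) => [l ->|->]; last by rewrite hvec_self mulr0 subrr !mulr0.
  have := tX i j (chart_pt i z) hj l.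
  rewrite {1}/fvec (meval_eq _ (trans_chart_pt zi zj)) hvec_lift /fvec => ->.
  rewrite /dtrans !hcoord_chart_pt // opprB addrC expfzDr ?mulf_neq0 ?invr_neq0 // expr1z.
  rewrite expfzMl exprz_inv opprK -invr_expz.
  have zjd : z j ^ d != 0 by rewrite expfz_neq0.
  by field; rewrite zi zj zjd.
have compat i j k : 'X_j * ('X_j ^+ T * Y i k - 'X_i ^+ T * Y j k) =
    'X_k * ('X_j ^+ T * Y i j).
  apply: (@mpoly_eq_overlap i j) => z zi zj.
  rewrite !(mevalM, mevalB) !rmorphXn /= !mevalXU !evY //.
  have zD l : z l != 0 -> z l ^+ D = z l ^+ T * z l ^ d.
    by move=> zl; rewrite [_ ^+ D]exprnP [_ ^+ T]exprnP -expfzDr // TE subrK.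
  rewrite !zD // mulrBr.
  have := cone i j z k zi zj; set u := hvec j _ k; set v := hvec i _ k; set t := hvec i _ j.
  move=> E; transitivity (z i ^+ T * z j ^+ T * (z j * (z i ^ d * v) - z j * (z j ^ d * u))).
    by ring.
  by rewrite E; ring.
pose Yk i := kvec N (fun k => Y i (inord k)).
have grYk i : gr (ihom D) 1 (Yk i).
  by apply: gr_kvec => [|k _]; [exact: subspace_ihomog | exact: hY].
have ekmulC s (u : kos S N) : kmap (mulop s) (ek Z u) = ek Z (kmap (mulop s) u).
  by apply: kmap_ek => i _ c; exact: mulopC.
have ekz (u : kos S N) : ek Z (ek Z u) = 0.
  by apply: ekek => i j _ _ c; exact: mulopC.
have ekB (u v : kos S N) : ek Z (u - v) = ek Z u - ek Z v by exact: linearB.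
pose B i := ek Z (Yk i).
have hB i : gr (ihom (D%:Z + 1)) 2 (B i).
  apply: (gr_ek (p := 1)) (grYk i) => [|k c _]; first exact: subspace_ihomog.
  by apply: ihomog_mulop; exact: ihomogXU.
have glueB i j : kmap (mulop ('X_j ^+ T)) (B i) = kmap (mulop ('X_i ^+ T)) (B j).
  apply/eqP; rewrite -subr_eq0; apply/eqP.
  apply: (@kmap_inj0 C n (mulop 'X_j)) => [c /eqP|].
    by rewrite /mulop mulf_eq0 -[_ == 0 :> S]msupp_eq0 msuppX => /eqP.
  rewrite !ekmulC -ekB ekmulC /Yk !kmap_kvec kvecB kmap_kvec.
  rewrite (@eq_kvec _ _ _ _ (Z^~ ('X_j ^+ T * Y i j))) => [|k _].
    by rewrite -ek_kconst ekz.
  exact: (compat i j (inord k)).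
have [x xp xE] := glue_kos n0 hB glueB.
have ex0 : ek Z x = 0.
  apply: (@kmap_inj0 C n (mulop ('X_ord0 ^+ T))) => [c|].
    by move=> c0; apply: (@mulX_inj C n ord0 T); rewrite /= mulr0.
  by rewrite ekmulC -xE ekz.
have [y yp yE] : exists2 y, gr (ihom d) 1 y & x = ek Z y.
  have [|y yp ->] := ekz_exact _ xp ex0; first by lia.
  exists y => //; move: yp; rewrite (_ : D%:Z + 1 - T%:Z - 1 = d) //; lia.
exists y => //.
have xchart i : exists2 v, gr (ihom (D%:Z - 1)) 0 v &
    Yk i - kmap (mulop ('X_i ^+ T)) y = ek Z v.
  apply: eq_kvec_ek.
    apply: (subspaceB (subspace_gr _ _ (@subspace_ihomog _ _ _))) => //.
    apply: gr_kmap yp => c hc; have -> : D%:Z = d + T%:Z by lia.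
    by apply: ihomog_mulop hc; rewrite -[T%:Z]mul1r; apply/ihomogXn/ihomogXU.
  by rewrite ekB -ekmulC -yE -xE subrr.
apply/ffunP => i; apply/ffunP => l; apply/eqP; rewrite -subr_eq0; apply/eqP.
apply: mpoly_eq0_meval => p; rewrite mevalB meval_vfield_of.
have [v /gr0_kconst[_ ->]] := xchart i; rewrite ek_kconst => E.
have Ek (k : 'I_N) : hvec i (fvec X i p) k - (kcoord k y).@[hcoord i p] =
    hcoord i p k * (kcst v).@[hcoord i p].
  have xi : hcoord i p i != 0 by rewrite hcoord_self oner_neq0.
  have := congr1 (fun u => (kcoord k u).@[hcoord i p]) E.
  rewrite kcoord_kvec // zopE mevalM mevalXU => <-.
  have -> (u u' : kos S N) : kcoord k (u - u') = kcoord k u - kcoord k u' by exact: linearB.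
  rewrite kcoord_kmap kcoord_kvec // inord_val mevalB mevalM rmorphXn /= mevalXU.
  rewrite evY // hcoord_self !expr1n !mul1r; congr (_ - _).
  by rewrite /hvec; case: unlift => // l'; apply/esym/meval_eq/chart_pt_hcoord.
have := Ek (lift i l); have := Ek i.
rewrite hvec_self hvec_lift hcoord_self hcoord_lift /fvec.
set a := (kcoord i y).@[_]; set b := (kcoord _ y).@[_].
set c := (kcst v).@[_]; set q := (X i l).@[_].
rewrite mul1r sub0r => <- Eq; rewrite -[q](subrK b) Eq; ring.
Qed.
End Global.

(** * Dimensions *)

Section HasDim.
Variable F : fieldType.

Lemma eq_has_dim (L : lmodType F) (V V' : L -> Prop) N :
  (forall x, V x <-> V' x) -> has_dim V N -> has_dim V' N.
Proof.
move=> VV' [b [Vb fb sb]]; exists b; split=> [i||x /VV' /sb] //.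
exact/VV'.
Qed.

Lemma has_dim0 (L : lmodType F) (V : L -> Prop) : (forall x, V x -> x = 0) -> has_dim V 0.
Proof.
move=> V0; exists (fun=> 0); split=> [[]|c _ []|x /V0 ->] //.
by exists (fun=> 0); rewrite big_ord0.
Qed.

Lemma has_dim_prod (L1 L2 : lmodType F) (V1 : L1 -> Prop) (V2 : L2 -> Prop) N1 N2 :
  V1 0 -> V2 0 ->
  has_dim V1 N1 -> has_dim V2 N2 ->
  has_dim (fun x : (L1 * L2)%type => V1 x.1 /\ V2 x.2) (N1 + N2).
Proof.
move=> V10 V20 [b1 [Vb1 fb1 sb1]] [b2 [Vb2 fb2 sb2]].
exists (fun i => match split i with inl j => (b1 j, 0) | inr j => (0, b2 j) end).
have E (c : 'I_(N1 + N2) -> F) : \sum_i c i *: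
    (match split i with inl j => (b1 j, 0) | inr j => (0, b2 j) end : (L1 * L2)%type) =
    (\sum_j c (lshift N2 j) *: b1 j, \sum_j c (rshift N1 j) *: b2 j).
  rewrite big_split_ord /=.
  under eq_bigr do rewrite (unsplitK (inl _)).
  under [X in _ + X]eq_bigr do rewrite (unsplitK (inr _)).
  rewrite [LHS]surjective_pairing /=.
  rewrite !(big_morph fst (id1 := 0) (op1 := +%R)) //.
  rewrite !(big_morph snd (id1 := 0) (op1 := +%R)) //=.
  rewrite [X in (_ + X, _)]big1 ?addr0 => [|j _]; last by rewrite scaler0.
  by rewrite [X in (_, X + _)]big1 ?add0r // => j _; rewrite scaler0.
split=> [i|c|[x1 x2] /= [/sb1[c1 ->] /sb2[c2 ->]]].
- case: split => j; split => /=; auto.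
- rewrite E => -[/fb1 c1 /fb2 c2] i; rewrite -(splitK i).
  by case: split => j /=.
exists (fun i => match split i with inl j => c1 j | inr j => c2 j end).
rewrite E; congr (_, _); apply: eq_bigr => j _.
  by rewrite (unsplitK (inl _)).
by rewrite (unsplitK (inr _)).
Qed.

(** The rank theorem.  In coordinates with respect to a basis of V the kernel is
    the row space of M; a basis of a complement of M maps to a basis of the
    image. *)
Lemma has_dim_image (L L' : lmodType F) (f : {linear L -> L'}) (V : L -> Prop) A K :
  subspace V ->
  has_dim V A -> has_dim (fun x => V x /\ f x = 0) K ->
  has_dim (fun y => exists2 x, V x & y = f x) (A - K).
Proof.
move=> sV [b [Vb fb sb]] [kb [Vkb fkb skb]].
pose comb (u : 'rV[F]_A) := \sum_i u 0 i *: b i.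
have combD u v : comb (u + v) = comb u + comb v.
  by rewrite /comb -big_split; apply: eq_bigr => i _; rewrite mxE scalerDl.
have combZ c u : comb (c *: u) = c *: comb u.
  by rewrite /comb scaler_sumr; apply: eq_bigr => i _; rewrite mxE scalerA.
have comb_mul K' (u : 'rV[F]_K') (M : 'M[F]_(K', A)) :
    comb (u *m M) = \sum_j u 0 j *: comb (row j M).
  rewrite /comb; under [RHS]eq_bigr do rewrite scaler_sumr.
  rewrite exchange_big; apply: eq_bigr => i _ /=.
  by rewrite mxE scaler_suml; apply: eq_bigr => j _; rewrite mxE scalerA.
have comb_inj u : comb u = 0 -> u = 0.
  by move=> /fb u0; apply/rowP => i; rewrite mxE u0.
have combV u : V (comb u).
  rewrite /comb; apply: big_ind => [|x y|i _]; first exact: sV.1.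
    exact: subspaceD.
  exact: subspaceZ.
have comb_surj x : V x -> exists u, x = comb u.
  move=> /sb[c ->]; exists (\row_i c i).
  by apply: eq_bigr => i _; rewrite mxE.
have /fin_all_exists[kc kcE] : forall j, exists u, kb j = comb u.
  by move=> j; apply: comb_surj; case: (Vkb j).
pose M : 'M[F]_(K, A) := \matrix_j kc j.
have combM (u : 'rV[F]_K) : comb (u *m M) = \sum_j u 0 j *: kb j.
  by rewrite comb_mul; apply: eq_bigr => j _; rewrite rowK kcE.
have freeM : row_free M.
  rewrite -kermx_eq0; apply/rowV0P => u /sub_kermxP uM.
  apply/rowP => j; rewrite mxE; apply: fkb.
  by rewrite -combM uM /comb big1 // => i _; rewrite mxE scale0r.
pose W := row_base M^C%MS.
have rkW : \rank M^C%MS = (A - K)%N by rewrite mxrank_compl (eqP freeM).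
rewrite -rkW; exists (fun j => f (comb (row j W))).
have fcombW (c : 'I_(\rank M^C%MS) -> F) :
    \sum_i c i *: f (comb (row i W)) = f (comb ((\row_i c i) *m W)).
  rewrite comb_mul linear_sum; apply: eq_bigr => i _.
  by rewrite linearZ mxE.
split=> [j|c|_ [x /comb_surj[u ->] ->]].
- by exists (comb (row j W)).
- rewrite fcombW => f0.
  have [|d dE] := skb (comb ((\row_i c i) *m W)); first by split.
  have E : (\row_i c i) *m W = (\row_j d j) *m M.
    apply/eqP; rewrite -subr_eq0; apply/eqP/comb_inj.
    rewrite -scaleN1r combD combZ combM dE scaleN1r; apply/eqP; rewrite subr_eq0.
    by apply/eqP/eq_bigr => j _; rewrite mxE.
  have : ((\row_i c i) *m W <= M :&: M^C)%MS.
    rewrite sub_capmx {1}E submxMl /=.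
    by apply: submx_trans (submxMl _ _) _; rewrite eq_row_base.
  rewrite capmx_compl submx0 mulmx_free_eq0 ?row_base_free // => /eqP c0 i.
  by have := congr1 (fun v : 'rV_ _ => v 0 i) c0; rewrite !mxE.
have : (u <= M + W)%MS.
  rewrite (adds_eqmx (eqmx_refl _) (eq_row_base _)).
  by apply: submx_full; exact: addsmx_compl_full.
case/sub_addsmxP => -[u1 u2] /= ->.
exists (fun i => u2 0 i); rewrite fcombW combD linearD combM linear_sum big1 ?add0r.
  by congr (f (comb (_ *m _))); apply/rowP => i; rewrite mxE.
by move=> j _; rewrite linearZ /= (Vkb j).2 scaler0.
Qed.
End HasDim.

Section Count.
Variables (C : fieldType) (n : nat).
Local Notation N := n.+1.
Local Notation S := {mpoly C[N]}.
Local Notation ihom := (@ihomog C N).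

(** The dimension of the space of homogeneous polynomials of degree k in n + 1
    variables; it is 0 for negative k. *)
Definition hdim (k : int) : nat := if k is Posz k' then 'C(k' + n, n) else 0.

Lemma has_dim_ihomog k : has_dim (ihom k) (hdim k).
Proof.
case: k => k; last by apply: has_dim0 => p; apply: ihomog_lt0.
have -> : hdim k = size [seq s2m t | t : k.-tuple 'I_N <- enum (basis N k)].
  by rewrite size_basis /= -bin_sub ?leq_addl // addnK.
set s := [seq _ | _ <- _].
have us : uniq s := uniq_basis N k.
have mem_s m : (m \in s) = (mdeg m == k) by rewrite -basis_cover.
pose mm (i : 'I_(size s)) := tnth (in_tuple s) i.
have mm_inj i j : (mm i == mm j) = (i == j).
  by rewrite /mm !(tnth_nth 0%MM) /= nth_uniq.
exists (fun i => 'X_[mm i]); split=> [i m|c c0 i|p hp].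
- rewrite msuppX inE => /eqP->; congr Posz; apply/eqP.
  by rewrite -mem_s mem_tnth.
- have := congr1 (mcoeff (mm i)) c0; rewrite mcoeff0 raddf_sum (bigD1 i) //= big1.
    by rewrite mcoeffZ mcoeffX eqxx mulr1 addr0.
  by move=> j ji; rewrite mcoeffZ mcoeffX mm_inj (negPf ji) mulr0.
exists (fun i => p@_(mm i)).
have -> : \sum_i p@_(mm i) *: 'X_[mm i] = \sum_(m <- s) p@_m *: 'X_[m] :> S.
  by rewrite [RHS]big_tnth.
apply/mpolyP => m; rewrite raddf_sum /=.
have [ms|] := boolP (m \in s).
  rewrite (bigD1_seq m) //= big1 => [|m' m'm]; rewrite mcoeffZ mcoeffX.
    by rewrite eqxx mulr1 addr0.
  by rewrite (negPf m'm) mulr0.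
move=> ms; rewrite big1_seq => [|m' /andP[_ m's]].
  apply/eqP; rewrite mcoeff_eq0; apply: contra ms => /hp; rewrite mem_s.
  by case=> ->.
rewrite mcoeffZ mcoeffX; case: eqP => [E|]; last by rewrite mulr0.
by rewrite -E m's in ms.
Qed.

Lemma has_dim_gr k M (p : nat) : has_dim (@gr C S (ihom k) M p) ('C(M, p) * hdim k).
Proof.
have z q M' : @gr C S (ihom k) M' q 0 by exact: (subspace_gr _ _ (@subspace_ihomog _ _ _)).1.
elim: M p => [|M IHM] [|p].
- by rewrite mul1n; exact: has_dim_ihomog.
- by rewrite mul0n; apply: has_dim0.
- rewrite bin0 mul1n -[hdim k]addn0.
  apply: (has_dim_prod (z _ _) (z _ _)); first by have := IHM 0%N; rewrite bin0 mul1n.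
  by apply: has_dim0 => x; apply: gr_lt0.
rewrite binS mulnDl; apply: (has_dim_prod (z _ _) (z _ _)) => //.
have -> : p.+1%:Z - 1 = p by lia.
exact: IHM.
Qed.
End Count.

Lemma double_bin2 k : (2 * 'C(k.+1, 2) = k.+1 * k)%N.
Proof. by rewrite -mul_bin_diag bin1. Qed.

(** The alternating sum of the dimensions in exterior degrees 2, 1, 0, in
    polynomial degrees e, e - 1, e - 2.  Over the common factor
    X = 'C(e + n - 2, n - 2) it is a polynomial identity. *)
Lemma bin_count n (e : nat) : (2 <= n)%N ->
  ('C(n.+1, 2) * hdim n e - ('C(n.+1, 1) * hdim n (e%:Z - 1) - 'C(n.+1, 0) * hdim n (e%:Z - 2)) =
   'C(e + n.+1, 2) * 'C(e + n - 2, n - 2))%N.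
Proof.
move=> n2; suff H : ('C(n.+1, 2) * hdim n e + hdim n (e%:Z - 2) =
    'C(e + n.+1, 2) * 'C(e + n - 2, n - 2) + n.+1 * hdim n (e%:Z - 1))%N.
  have le : (hdim n (e%:Z - 2) <= n.+1 * hdim n (e%:Z - 1))%N.
    case: e {H} => [//|[//|e]]; have -> : e.+2%:Z - 2 = e by lia.
    have -> : e.+2%:Z - 1 = e.+1 by lia.
    rewrite /= addSn; apply: (@leq_trans 'C((e + n).+1, n)); last exact: leq_pmull.
    by apply: leq_bin2l.
  by rewrite bin0 bin1 mul1n; lia.
case: n n2 => [//|[//|q]] _; rewrite !addnS !subSS !subn0.
have T1 := double_bin2 q.+2.
case: e => [|[|e]].
- by rewrite /= !add0n !binn !muln1 muln0.
- rewrite /= add1n binn muln1 addn0 add1n binSn -[in 'C(q.+1, q)]add1n binSn.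
  by have T2 := double_bin2 q.+3; nia.
have -> : e.+2%:Z - 2 = e by lia.
have -> : e.+2%:Z - 1 = e.+1 by lia.
have T2 := double_bin2 (e + q).+4.
rewrite /= !addSn !addnS.
have y_X := mul_bin_left (e + q).+2 q; have c_y := mul_bin_left (e + q).+2 q.+1.
have -> : 'C((e + q).+4, q.+2) =
    ('C((e + q).+2, q.+2) + 2 * 'C((e + q).+2, q.+1) + 'C((e + q).+2, q))%N.
  by rewrite !binS; lia.
have -> : 'C((e + q).+3, q.+2) = ('C((e + q).+2, q.+2) + 'C((e + q).+2, q.+1))%N by rewrite binS.
move: y_X c_y.
have -> : ((e + q).+2 - q = e.+2)%N by lia.
have -> : ((e + q).+2 - q.+1 = e.+1)%N by lia.
move: T1 T2.
move: 'C(_.+3, 2) => t1; move: 'C((e + q).+1.+4, 2) => t2.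
move: 'C(_, q.+2) => c; move: 'C(_, q.+1) => y; move: 'C(_, q) => X T1 T2 yX cy.
(* Both sides are now linear in c, y, X, which are proportional. *)
have cX : (c * (q.+1 * q.+2) = (e.+1 * e.+2) * X)%N by nia.
nia.
Qed.

(** * Invariant vector fields *)

Section Contraction.
Variables (C : numFieldType) (n : nat).
Local Notation N := n.+1.
Local Notation S := {mpoly C[N]}.
Local Notation ihom := (@ihomog C N).
Local Notation Z := (@zop C n).
Variables (a : 'I_N -> S) (delta : int) (w : chart_family C n).
Hypotheses (ha : forall j, ihom delta (a j)) (az : \sum_j a j * 'X_j = 0)
  (aw : forall i l x, (w i l).@[x] = (a (lift i l)).@[hcoord i x]).

Definition anat (k : nat) : S := a (inord k).

Lemma anatE (j : 'I_N) : anat j = a j.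
Proof. by rewrite /anat inord_val. Qed.

(** The multiples of the Euler field do not contribute, as z is tangent to the
    distribution. *)
Lemma meval_contraction (y : kos S N) i x :
  (contraction (vfield_of y) w i).@[x] = (\sum_j a j * kcoord j y).@[hcoord i x].
Proof.
set hx := hcoord i x.
have az_i : (a i).@[hx] = - \sum_l (a (lift i l)).@[hx] * x l.
  apply/eqP; rewrite -addr_eq0; apply/eqP.
  have := congr1 (meval hx) az; rewrite meval0 raddf_sum (bigD1_ord i) //= => E; rewrite -[RHS]E.
  rewrite mevalM mevalXU /hx hcoord_self mulr1; congr (_ + _).
  by apply: eq_bigr => l _; rewrite mevalM mevalXU hcoord_lift.
rewrite [RHS]raddf_sum (bigD1_ord i) //= mevalM az_i mulNr mulr_suml.
rewrite /contraction raddf_sum /= addrC -sumrB; apply: eq_bigr => l _.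
by rewrite mevalM meval_vfield_of aw mevalM -/hx; ring.
Qed.

Lemma contraction_eq0 d (y : kos S N) : gr (ihom d) 1 y ->
  (forall i, contraction (vfield_of y) w i = 0) <-> dk (yop anat) y = 0.
Proof.
move=> yd; have [hy yE] := gr1_kvec yd.
have dE : dk (yop anat) y = kconst N (\sum_j a j * kcoord j y).
  rewrite {1}yE dk_kvec; congr kconst; apply: eq_bigr => j _.
  by rewrite /yop /= anatE.
split=> [c0|dy i].
  rewrite dE (_ : \sum_j _ = 0) ?linear0 //.
  apply: (@ihomog_eq0_chart C n (delta + d) ord0) => [|x].
    apply: big_ind => [|u v|j _]; first exact: (@subspace_ihomog C N _).1.
      exact: (subspaceD (@subspace_ihomog _ _ _)).
    by apply: ihomogM => //; apply: hy.
  by rewrite -meval_contraction c0 meval0.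
apply: mpoly_eq0_meval => x; rewrite meval_contraction.
by rewrite -[\sum_j _](@kconstK _ _ N) -dE dy linear0 meval0.
Qed.
End Contraction.

(** If the a_j were constants, the derivative of the sum of the a_j z_j with
    respect to z_j0 would be a_j0. *)
Lemma degree_gt0 (C : numFieldType) n (a : 'I_n.+1 -> {mpoly C[n.+1]}) delta :
  (forall j, ihomog delta (a j)) -> \sum_j a j * 'X_j = 0 ->
  (exists j, a j != 0) -> 0 < delta.
Proof.
move=> ha az [j0 aj0]; rewrite ltNge; apply: contra aj0 => d0.
have [d1|d1] := ltP delta 0; first by rewrite (ihomog_lt0 d1 (ha j0)).
have d00 : delta = 0 by lia.
have := congr1 (mderiv j0) az; rewrite linear0 linear_sum (bigD1 j0) //= big1 => [|j jj0].
  rewrite mderivM (ihomog_lt0 _ (ihomog_deriv (i := j0) (ha j0))) ?d00 //.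
  rewrite mul0r add0r mderivX mnm1E eqxx scale1r addr0.
  have -> : (U_(j0) - U_(j0) = 0 :> 'X_{1..n.+1})%MM.
    by apply/mnmP => l; rewrite mnmBE subnn mnm0E.
  by rewrite mpolyX0 mulr1 => ->.
rewrite mderivM (ihomog_lt0 _ (ihomog_deriv (i := j0) (ha j))) ?d00 //.
by rewrite mul0r add0r mderivX mnm1E (negPf jj0) scale0r mulr0.
Qed.

Section Main.
Variables (C : numFieldType) (n : nat) (m : int) (w : chart_family C n).
Local Notation N := n.+1.
Local Notation S := {mpoly C[N]}.
Local Notation ihom := (@ihomog C N).
Local Notation Z := (@zop C n).
Variables (a : 'I_N -> S).
Hypotheses (n3 : (3 <= n)%N) (m0 : 0 <= m)
  (ha : forall j, ihom (m + 1) (a j)) (az : \sum_j a j * 'X_j = 0)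
  (aw : forall i l x, (w i l).@[x] = (a (lift i l)).@[hcoord i x])
  (exa : forall p, 2 <= p -> exact_at ihom (yop (anat a)) (m + 1) N p).
Local Notation da := (@dk C S (yop (anat a)) N).

Let n0 : (0 < n)%N. Proof. exact: leq_trans n3. Qed.
Let n1 : (1 < n)%N. Proof. exact: leq_trans n3. Qed.

Let ha' k : (k < N)%N -> ihom (m + 1) (anat a k).
Proof. by move=> _; exact: ha. Qed.

Let az' : \sum_(i < N) anat a i * 'X_i = 0.
Proof. by rewrite -[RHS]az; apply: eq_bigr => i _; rewrite anatE. Qed.

Let vfieldD (u v : kos S N) : vfield_of (u + v) = vfield_of u + vfield_of v.
Proof. exact: linearD. Qed.

Let vfieldN (u : kos S N) : vfield_of (- u) = - vfield_of u.
Proof. exact: linearN. Qed.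

Let vfield0 : vfield_of (0 : kos S N) = 0.
Proof. exact: linear0. Qed.

Let da0 : da 0 = 0. Proof. exact: linear0. Qed.

Lemma invariant_lift d X : invariant_vfield w d X <->
  exists y, [/\ gr (ihom d) 1 y, da y = 0 & X = vfield_of y].
Proof.
split=> [[tX cX]|[y [yd dy ->]]].
  have [y yd XE] := family_of_vfield n0 n1 tX.
  exists y; split=> //; apply/(contraction_eq0 ha az aw yd) => i.
  by rewrite -XE.
split; first exact: vfield_of_twisted.
exact/(contraction_eq0 ha az aw yd).
Qed.

(** The zigzag starts in exterior degree 1, with N = 1 + 2 s only if n = 2 s. *)
Lemma invariant_surj d X :
  (~~ odd n -> d <> (n./2)%:Z * m) -> invariant_vfield w d X ->
  exists2 u, gr (ihom (d - (m + 1))) 2 u & X = vfield_of (da u).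
Proof.
move=> nd /invariant_lift[y [yd dy ->]].
have dey : da (ek Z y) = 0 by rewrite (da_ez az') dy linear0 oppr0.
have [||s sN|u [v [ud vd ->]]] := @double_chase _ _ _ _ ha' az' exa n 1 d y _ _ _ yd dey.
- by lia.
- by [].
-  have : ~~ odd n /\ n./2 = s by lia.
  by case=> [/nd dn n2]; rewrite n2 in dn; nia.
exists u; first exact: ud.
by rewrite vfieldD (vfield_of_ek vd) addr0.
Qed.

(** The zigzag starts in exterior degree 2, with N = 2 + 2 s only if n is odd.
    The term d u3 that it produces vanishes, because u3 would have polynomial
    degree d - 2 (m + 1) < 0. *)
Lemma invariant_kernel d u : d < 2 * (m + 1) ->
  (odd n -> d <> ((n.+1)./2)%:Z * m + 1) ->
  gr (ihom (d - (m + 1))) 2 u -> vfield_of (da u) = 0 ->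
  exists2 v, gr (ihom (d - (m + 1) - 1)) 1 v & u = ek Z v.
Proof.
move=> dm nd ud u0.
have dud : gr (ihom d) 1 (da u) by have := gr_da ha' ud; rewrite subrK.
have [v vd vE] := vfield_of_eq0 n0 dud u0.
have deu : da (ek Z u) = 0.
  by rewrite (da_ez az') vE ez_ez oppr0.
have [||s sN|u3 [v1 [ud3 vd1 ->]]] := @double_chase _ _ _ _ ha' az' exa n 2 _ u _ _ _ ud deu.
- by lia.
- by [].
-  have : odd n /\ (n.+1)./2 = s.+1 by lia.
  by case=> [/nd dn n2]; rewrite n2 in dn; nia.
exists v1 => //.
have -> : u3 = 0.
  by apply: gr_eq0 ud3 => c; apply: ihomog_lt0; lia.
by rewrite linear0 add0r.
Qed.

Lemma invariant_dim d : m + 1 <= d < 2 * (m + 1) ->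
  (~~ odd n -> d <> (n./2)%:Z * m) ->
  (odd n -> d <> ((n.+1)./2)%:Z * m + 1) ->
  has_dim (invariant_vfield w d)
    ('C(absz (d - m + n%:Z)%R, absz (d - m + n%:Z - 2)%R)
     * 'C(absz (d - m + n%:Z - 3)%R, n - 2))%N.
Proof.
move=> /andP[d1 d2] nd1 nd2.
have [e eE] : exists e : nat, d - (m + 1) = e%:Z by exists (absz (d - (m + 1))%R); lia.
have sg k p : subspace (@gr C S (ihom k) N p) by apply: subspace_gr; exact: subspace_ihomog.
(* [ek Z] is injective in exterior degree 0, and exact in degrees 1 and 2. *)
have dim0 : has_dim (fun x : kos S N => gr (ihom (e%:Z - 2)) 0 x /\ ek Z x = 0) 0.
  apply: has_dim0 => x [xd x0].
  have [|v vd ->] := ekz_exact _ xd x0; first by lia.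
  by rewrite (gr_lt0 _ vd) ?linear0.
have dim1 := has_dim_image (sg _ _) (has_dim_gr C n (e%:Z - 2) N 0) dim0.
have dim1' : has_dim (fun x : kos S N => gr (ihom (e%:Z - 1)) 1 x /\ ek Z x = 0)
    ('C(N, 0) * hdim n (e%:Z - 2)).
  rewrite subn0 in dim1; apply: eq_has_dim dim1 => x; split=> [[v vd ->]|[xd x0]].
    rewrite ez_ez; split=> //; have := gr_ez vd.
    by rewrite (_ : e%:Z - 2 + 1 = e%:Z - 1) //; lia.
  have [|v vd ->] := ekz_exact _ xd x0; first by lia.
  by exists v => //; move: vd; rewrite (_ : e%:Z - 1 - 1 = e%:Z - 2) //; lia.
have dim2 := has_dim_image (sg _ _) (has_dim_gr C n (e%:Z - 1) N 1) dim1'.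
pose f : {linear kos S N -> chart_family C n} := @vfield_of C n \o da.
have fE x : f x = vfield_of (da x) by [].
have dim2' : has_dim (fun x : kos S N => gr (ihom e) 2 x /\ f x = 0)
    ('C(N, 1) * hdim n (e%:Z - 1) - 'C(N, 0) * hdim n (e%:Z - 2)).
  apply: eq_has_dim dim2 => x; split=> [[v vd ->]|[xd x0]].
    split; first by have := gr_ez vd; rewrite subrK.
    by rewrite fE (da_ez az') vfieldN (vfield_of_ek (gr_da ha' vd)) oppr0.
  rewrite -eE; apply: invariant_kernel => //; by rewrite eE.
have := has_dim_image (sg _ _) (has_dim_gr C n e N 2) dim2'.
rewrite bin_count // => dimV.
have -> : absz (d - m + n%:Z)%R = (e + N)%N by lia.
have -> : absz (d - m + n%:Z - 2)%R = (e + N - 2)%N by lia.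
have -> : absz (d - m + n%:Z - 3)%R = (e + n - 2)%N by lia.
rewrite bin_sub; last by lia.
apply: eq_has_dim dimV => X; split=> [[u ud ->]|VX].
  apply/invariant_lift; exists (da u); split=> //; last exact: da_da.
  by have := gr_da ha' ud; rewrite -eE subrK.
by have [u ud XE] := invariant_surj nd1 VX; exists u; rewrite // -eE.
Qed.

Lemma invariant_eq0 d X : d < m + 1 -> (~~ odd n -> d <> (n./2)%:Z * m) ->
  invariant_vfield w d X -> X = 0.
Proof.
move=> dm nd /(invariant_surj nd)[u ud ->].
have -> : u = 0 by apply: gr_eq0 ud => c; apply: ihomog_lt0; lia.
by rewrite da0 vfield0.
Qed.
End Main.

Unset Implicit Arguments.

Theorem theorem1p5 (R : realType) (n : nat) (m : int)
    (w : chart_family R[i] n) :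
  (3 <= n)%N ->
  induces_distribution m w ->
  has_singularity w ->
  isolated_singularities w ->
  (forall d : int,
     m + 1 <= d < 2 * (m + 1) ->
     (~~ odd n -> d <> (n./2)%:Z * m) ->
     (odd n -> d <> ((n.-1)./2)%:Z * m - 1 /\ d <> ((n.+1)./2)%:Z * m + 1) ->
     has_dim (invariant_vfield w d)
       ('C(absz (d - m + n%:Z)%R, absz (d - m + n%:Z - 2)%R)
        * 'C(absz (d - m + n%:Z - 3)%R, n - 2))%N)
  /\
  (forall d : int,
     d < m + 1 ->
     (~~ odd n -> d <> (n./2)%:Z * m) ->
     (odd n -> d <> ((n.-1)./2)%:Z * m - 1) ->
     forall X : chart_family R[i] n, invariant_vfield w d X -> X = 0).
Proof.
move=> n3 [w0 tw] _ iso; have n0 : (0 < n)%N by apply: leq_trans n3.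
have [a [ha az aw]] := form_of_family n0 tw.
have a0 : exists j, a j != 0.
  apply/existsP; apply: contraR w0; rewrite negb_exists => /forallP a0.
  apply/eqP/ffunP => i; apply/ffunP => l; rewrite !ffunE.
  apply: mpoly_eq0_meval => x.
  rewrite aw; have := a0 (lift i l); rewrite negbK => /eqP->; exact: meval0.
have m1 : m + 2 - 1 = m + 1 by lia.
rewrite m1 in ha; have d0 := degree_gt0 ha az a0.
have m0 : 0 <= m by lia.
have exa : forall p, 2 <= p -> exact_at (@ihomog R[i] n.+1) (yop (anat a)) (m + 1) n.+1 p.
  apply: (koszul_exact d0) => [k _|i x Sx]; first exact: ha.
  have sing x' : (forall k, (k < n.+1)%N -> (anat a k).@[hcoord i x'] = 0) -> singular_at w i x'.
    by move=> S' l; rewrite aw -anatE; apply: S'.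
  have [e e0 eP] := iso i x (sing x Sx).
  by exists e => // y /sing; exact: eP.
split=> [d dm nd1 nd2|d dm nd1 _ X].
  by apply: (invariant_dim n3 m0 ha az aw exa dm nd1) => /nd2[].
exact: (invariant_eq0 n3 m0 ha az aw exa dm nd1).
Qed.
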